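(* Let $\Lambda$ and $\Lambda'$ be Gorenstein algebras of G-dimension $1$ which are of finite Cohen-Macaulay type. Then $\Lambda$ and $\Lambda'$ are Morita equivalent if and only if their Cohen-Macaulay Auslander algebras $\Gamma=\mathrm{Aus}(\mathrm{Gprj}\text{-}\Lambda)$ and $\Gamma'=\mathrm{Aus}(\mathrm{Gprj}\text{-}\Lambda')$ are Morita equivalent.
   Context: An artin algebra $\Lambda$ is called Gorenstein of G-dimension $n$ if both $\mathrm{id}\,{}_\Lambda\Lambda$ and $\mathrm{id}\,\Lambda_\Lambda$ are finite, in which case they are equal, and their common value is $n$. A totally acyclic complex of projectives is an acyclic complex $\mathbf{P}$ of projective $\Lambda$-modules such that $\mathrm{Hom}_\Lambda(\mathbf{P},Q)$ is acyclic for every projective $\Lambda$-module $Q$; the syzygies of such complexes are the Gorenstein projective modules. $\mathrm{Gprj}\text{-}\Lambda$ is the full subcategory of $\mathrm{mod}\text{-}\Lambda$ (finitely generated right $\Lambda$-modules) consisting of the finitely generated Gorenstein projective modules. $\Lambda$ is of finite Cohen-Macaulay type if $\mathrm{Gprj}\text{-}\Lambda$ has only finitely many indecomposable modules up to isomorphism. Then $\mathrm{Gprj}\text{-}\Lambda=\mathrm{add}(G)$ for some $G$ (an additive generator), where $\mathrm{add}(G)$ is the class of direct summands of finite direct sums of copies of $G$, and the Cohen-Macaulay Auslander algebra is $\mathrm{Aus}(\mathrm{Gprj}\text{-}\Lambda)=\mathrm{End}_\Lambda(G)$, which up to Morita equivalence is independent of the choice of $G$. *)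

(* Defs.v *)
From HB Require Import structures.
From mathcomp Require Import all_boot all_order all_algebra boolp.

Set Implicit Arguments.
Unset Strict Implicit.
Unset Printing Implicit Defensive.

Import GRing.Theory.
Local Open Scope ring_scope.

(* A right R-module is a left module over the converse ring, with            *)
(* [a *: v] standing for [v . a].                                            *)
Notation rmodType R := (lmodType (R^c)).

Section Modules.
Variable R : pzRingType.
Implicit Types M N P Q G : lmodType R.

Definition fin_gen M : Prop :=
  exists (n : nat) (g : 'I_n -> M),
    forall x : M, exists c : 'I_n -> R, x = \sum_i c i *: g i.

Definition is_zero_mod M : Prop := forall x : M, x = 0.

Definition isomorphic M N : Prop := exists f : {linear M -> N}, bijective f.

Definition projective P : Prop :=
  forall (M N : lmodType R) (g : {linear M -> N}) (f : {linear P -> N}),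
    (forall y : N, exists x : M, g x = y) ->
    exists h : {linear P -> M}, forall x, g (h x) = f x.

Definition injective_mod Q : Prop :=
  forall (M N : lmodType R) (i : {linear M -> N}) (f : {linear M -> Q}),
    injective i ->
    exists h : {linear N -> Q}, forall x, h (i x) = f x.

(* M has an injective resolution 0 -> M -> I 0 -> I 1 -> ... with I i = 0    *)
(* for i > n.                                                                *)
Definition inj_dim_le M (n : nat) : Prop :=
  exists (I : nat -> lmodType R) (d : forall i, {linear I i -> I i.+1})
         (e : {linear M -> I 0%N}),
  [/\ forall i, injective_mod (I i),
      forall i, (n < i)%N -> is_zero_mod (I i),
      injective e,
      forall x : I 0%N, d 0%N x = 0 <-> exists y, e y = x
    & forall i (x : I i.+1), d i.+1 x = 0 <-> exists y, d i y = x].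

Definition inj_dim M (n : nat) : Prop :=
  inj_dim_le M n /\ forall m, inj_dim_le M m -> (n <= m)%N.

(* Complexes are indexed cohomologically by int; as i ranges over int, the   *)
(* conditions at P (i + 1) cover every degree.                               *)
Definition acyclic (P : int -> lmodType R)
    (d : forall i : int, {linear P i -> P (i + 1)}) : Prop :=
  forall (i : int) (x : P (i + 1)), d (i + 1) x = 0 <-> exists y, d i y = x.

Definition Hom_acyclic (P : int -> lmodType R)
    (d : forall i : int, {linear P i -> P (i + 1)}) Q : Prop :=
  forall (i : int) (f : {linear P (i + 1) -> Q}),
    (forall x, f (d i x) = 0) <->
    exists g : {linear P (i + 1 + 1) -> Q}, forall x, g (d (i + 1) x) = f x.

Definition totally_acyclic (P : int -> lmodType R)
    (d : forall i : int, {linear P i -> P (i + 1)}) : Prop :=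
  [/\ forall i, projective (P i), acyclic d
    & forall Q, projective Q -> Hom_acyclic d Q].

(* The map [e] identifies M with the syzygy ker (d i).                       *)
Definition Gorenstein_projective M : Prop :=
  exists (P : int -> lmodType R) (d : forall i : int, {linear P i -> P (i + 1)}),
    totally_acyclic d /\
    exists (i : int) (e : {linear M -> P i}),
      injective e /\ forall x : P i, d i x = 0 <-> exists y, e y = x.

Definition Gprj M : Prop := fin_gen M /\ Gorenstein_projective M.

Definition indecomposable M : Prop :=
  ~ is_zero_mod M /\
  forall A B : lmodType R, isomorphic (A * B)%type M ->
    is_zero_mod A \/ is_zero_mod B.

Definition in_add G M : Prop :=
  exists (n : nat) (N : lmodType R), isomorphic (M * N)%type {ffun 'I_n -> G}.

Definition additive_generator_Gprj G : Prop := forall M, Gprj M <-> in_add G M.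

End Modules.

Lemma linear_ext (R : pzRingType) (M N : lmodType R) (f g : {linear M -> N}) :
  f =1 g -> f = g.
Proof.
case: f g => [f [[f1] [f2]]] [g [[g1] [g2]]] /= /funext fg; subst g.
by rewrite (Prop_irrelevance f1 g1) (Prop_irrelevance f2 g2).
Qed.

(* Endomorphism ring, with composition as product, so that it acts on M from *)
(* the left and Hom(M, X) is a right module over it.                         *)
Section EndomorphismRing.
Variables (R : pzRingType) (M : lmodType R).

Definition End_mod : Type := {linear M -> M}.

HB.instance Definition _ := gen_eqMixin End_mod.
HB.instance Definition _ := gen_choiceMixin End_mod.

Lemma End_modP (f g : End_mod) :
  (f : {linear M -> M}) =1 (g : {linear M -> M}) -> f = g.
Proof. exact: linear_ext. Qed.

Definition End_zero : End_mod := (\0 : {linear M -> M}).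
Definition End_opp (f : End_mod) : End_mod :=
  (\- (f : {linear M -> M}) : {linear M -> M}).
Definition End_add (f g : End_mod) : End_mod :=
  ((f : {linear M -> M}) \+ (g : {linear M -> M}) : {linear M -> M}).
Definition End_one : End_mod := (idfun : {linear M -> M}).
Definition End_mul (f g : End_mod) : End_mod :=
  ((f : {linear M -> M}) \o (g : {linear M -> M}) : {linear M -> M}).

Fact End_addA : associative End_add.
Proof. by move=> f g h; apply: End_modP => x /=; rewrite addrA. Qed.
Fact End_addC : commutative End_add.
Proof. by move=> f g; apply: End_modP => x /=; rewrite addrC. Qed.
Fact End_add0 : left_id End_zero End_add.
Proof. by move=> f; apply: End_modP => x /=; rewrite add0r. Qed.
Fact End_addN : left_inverse End_zero End_opp End_add.
Proof. by move=> f; apply: End_modP => x /=; rewrite addNr. Qed.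
Fact End_mulA : associative End_mul.
Proof. by move=> f g h; apply: End_modP. Qed.
Fact End_mul1 : left_id End_one End_mul.
Proof. by move=> f; apply: End_modP. Qed.
Fact End_mulr1 : right_id End_one End_mul.
Proof. by move=> f; apply: End_modP. Qed.
Fact End_mulDl : left_distributive End_mul End_add.
Proof. by move=> f g h; apply: End_modP. Qed.
Fact End_mulDr : right_distributive End_mul End_add.
Proof. by move=> f g h; apply: End_modP => x /=; rewrite raddfD. Qed.

HB.instance Definition _ := GRing.isZmodule.Build End_mod
  End_addA End_addC End_add0 End_addN.
HB.instance Definition _ := GRing.Zmodule_isPzRing.Build End_mod
  End_mulA End_mul1 End_mulr1 End_mulDl End_mulDr.

End EndomorphismRing.

(* Morphisms are compared pointwise, which by [linear_ext] is the same as    *)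
(* comparing them with Leibniz equality.                                     *)
Record mod_functor (R S : pzRingType) := ModFunctor {
  fobj :> rmodType R -> rmodType S;
  fmap : forall M N : rmodType R, {linear M -> N} -> {linear fobj M -> fobj N};
  fmap_id : forall M : rmodType R, fmap (idfun : {linear M -> M}) =1 idfun;
  fmap_comp : forall (M N P : rmodType R)
    (g : {linear N -> P}) (f : {linear M -> N}),
    fmap (g \o f : {linear M -> P}) =1 fmap g \o fmap f
}.

Definition id_functor (R : pzRingType) : mod_functor R R :=
  @ModFunctor R R (fun M => M) (fun M N f => f)
    (fun M x => erefl) (fun M N P g f x => erefl).

Section Composition.
Variables (R S T : pzRingType) (G : mod_functor S T) (F : mod_functor R S).

Definition comp_fmap (M N : rmodType R) (f : {linear M -> N}) :
  {linear G (F M) -> G (F N)} := fmap G (fmap F f).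

Fact comp_fmap_id (M : rmodType R) :
  comp_fmap (idfun : {linear M -> M}) =1 idfun.
Proof.
move=> x; rewrite /comp_fmap -[RHS](@fmap_id _ _ G).
by congr (fmap G _ x); apply/linear_ext/fmap_id.
Qed.

Fact comp_fmap_comp (M N P : rmodType R)
    (g : {linear N -> P}) (f : {linear M -> N}) :
  comp_fmap (g \o f : {linear M -> P}) =1 comp_fmap g \o comp_fmap f.
Proof.
move=> x; rewrite /comp_fmap -[RHS](@fmap_comp _ _ G).
by congr (fmap G _ x); apply/linear_ext/fmap_comp.
Qed.

Definition comp_functor : mod_functor R T :=
  ModFunctor comp_fmap_id comp_fmap_comp.

End Composition.

Definition nat_isomorphic (R S : pzRingType) (F G : mod_functor R S) : Prop :=
  exists eta : forall M : rmodType R, {linear F M -> G M},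
    (forall M, bijective (eta M)) /\
    forall (M N : rmodType R) (f : {linear M -> N}),
      eta N \o fmap F f =1 fmap G f \o eta M.

Definition Morita_equivalent (R S : pzRingType) : Prop :=
  exists (F : mod_functor R S) (G : mod_functor S R),
    nat_isomorphic (comp_functor G F) (id_functor R) /\
    nat_isomorphic (comp_functor F G) (id_functor S).

(* Descending chain condition on ideals.                                     *)
Definition artinian (k : comPzRingType) : Prop :=
  forall I : nat -> {pred k^o},
    (forall n, GRing.submod_closed (I n)) ->
    (forall n, {subset I n.+1 <= I n}) ->
    exists N, forall n, (N <= n)%N -> I n =i I N.

Definition artin_algebra (k : comPzRingType) (L : algType k) : Prop :=
  artinian k /\ fin_gen L.

(* id of L as a left and as a right module over itself.                      *)
Definition Gorenstein (L : pzRingType) (n : nat) : Prop :=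
  inj_dim (L^o : lmodType L) n /\ inj_dim ((L^c)^o : rmodType L) n.

Definition finite_CM_type (L : pzRingType) : Prop :=
  exists (n : nat) (X : 'I_n -> rmodType L),
    forall M : rmodType L, Gprj M -> indecomposable M ->
      exists i, isomorphic M (X i).

(* Main.v *)
Require Import Defs.
From HB Require Import structures.
From mathcomp Require Import all_boot all_order all_algebra.
From mathcomp Require Import boolp finmap monalg.

Set Implicit Arguments.
Unset Strict Implicit.
Unset Printing Implicit Defensive.

Import GRing.Theory.
Local Open Scope ring_scope.

(** Call a module a lattice if it is finitely generated and embeds in a finite
free module. Over an artin algebra L that is Gorenstein of dimension 1 the
finitely generated Gorenstein projective modules are exactly the lattices
[Gprj_iff_lattice], so G is an additive generator of the lattices. The gain is
that finitely generated submodules of lattices are lattices, and that lattices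
are described by injective and surjective maps and finite free modules only,
which equivalences respect.

From L to End(G): an equivalence F : Mod-L -> Mod-L' is full, faithful and
additive, sends L to a progenerator [equiv_generator, equiv_reg_summand], and
therefore sends lattices to lattices [equiv_lattice]. So F(G) and G' are direct
summands of finite sums of each other, which makes End(F(G)) and End(G') Morita
equivalent [End_Morita], while End(F(G)) is isomorphic to End(G).

From End(G) to L: the image of the regular module under an equivalence
Mod-End(G) -> Mod-End(G') is a summand of a finite free module, and splitting
the corresponding idempotent matrix inside a power of G' gives another additive
generator Y of the lattices over L', with End(Y) isomorphic to End(G)
[Morita_end_iso]. A ring isomorphism between End(G) and End(Y) is an equivalence
between the categories of summands of powers of G and of Y, that is, between the
lattices over L and over L' [matched, transport]. It remains to recognise the
projective lattices categorically [matched_reg_summand]. Monomorphisms of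
lattices are the injective maps, since the regular module is a lattice. As the
image of a map of lattices is a lattice, a map is surjective if and only if it
factors through no proper subobject of its target; so the equivalence preserves
surjections, hence also the lattices onto which all surjections split. The
lattice P that corresponds to L is therefore a progenerator over L', and
L = End(L) = End(P) is Morita equivalent to End(L') = L' [recover_ring].

That lattices are Gorenstein projective is a statement on matrices. A matrix
pair can be exact for the row action (left modules) or for the column action
(right modules). Self-injective dimension at most 1 on one side kills Ext^2 with
values in the regular module, which says that a row-exact sequence of three
matrices is column-exact at its first spot, and the other side gives the mirror
image [cexact_of_inj_dim, rexact_of_inj_dim]. Since L is noetherian on both
sides, kernels are finitely generated on both sides; extending to the left by
row kernels and to the right by column kernels then produces a sequence that is
exact for both actions in every degree [exact_sequence], which is a totally
acyclic complex with the lattice as a syzygy. The noetherian property comes from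
the artinian base ring [artinian_noetherian]. *)

(** * Submodules, images and factorizations *)

Section Submodules.
Variables (R : pzRingType) (M : lmodType R).

Record submodule := Submodule {
  smem : M -> Prop;
  smem0 : smem 0;
  smemD : forall x y, smem x -> smem y -> smem (x + y);
  smemZ : forall a x, smem x -> smem (a *: x)
}.

Definition spred (S : submodule) : {pred M} := fun x => `[<smem S x>].

Variable S : submodule.

Lemma spredP x : reflect (smem S x) (x \in spred S).
Proof. exact: asboolP. Qed.

Fact spred_submod_closed : submod_closed (spred S).
Proof.
split=> [|a x y /spredP Sx /spredP Sy]; apply/spredP; first exact: smem0.
by apply: smemD => //; apply: smemZ.
Qed.
HB.instance Definition _ :=
  GRing.isSubmodClosed.Build R M (spred S) spred_submod_closed.

Record smod := SMod { smod_val : M; _ : smod_val \in spred S }.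
HB.instance Definition _ := [isSub for smod_val].
HB.instance Definition _ := [Choice of smod by <:].
HB.instance Definition _ := [SubChoice_isSubLmodule of smod by <:].

Definition smod_incl (x : smod) : M := val x.

Fact smod_incl_is_linear : linear smod_incl. Proof. by []. Qed.
HB.instance Definition _ :=
  GRing.isLinear.Build R smod M _ smod_incl smod_incl_is_linear.

Lemma smod_inclP (x : smod) : smem S (smod_incl x).
Proof. by apply/spredP; case: x. Qed.

Lemma smod_incl_inj : injective smod_incl.
Proof. exact: val_inj. Qed.

Definition smk (x : M) (Sx : smem S x) : smod := SMod (introT (spredP x) Sx).

Lemma smkK x (Sx : smem S x) : smod_incl (smk Sx) = x.
Proof. by []. Qed.

End Submodules.

Section LinearConstruct.
Variables (R : pzRingType) (M N : lmodType R).

Definition mklin (f : M -> N) (lf : linear f) : {linear M -> N} :=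
  HB.pack f (GRing.isLinear.Build R M N _ f lf).

Lemma mklinE f lf : @mklin f lf =1 f. Proof. by []. Qed.

End LinearConstruct.

Section LinearMaps.
Variables (R : pzRingType) (M N : lmodType R).

Lemma linear_inj0 (f : {linear M -> N}) :
  (forall x, f x = 0 -> x = 0) -> injective f.
Proof.
move=> f0 x y /eqP; rewrite -subr_eq0 -raddfB => /eqP/f0/eqP.
by rewrite subr_eq0 => /eqP.
Qed.

Lemma corestrict (S : submodule N) (f : {linear M -> N}) :
  (forall x, smem S (f x)) ->
  exists g : {linear M -> smod S}, forall x, smod_incl (g x) = f x.
Proof.
move=> Sf.
have lf : linear (fun x => smk (Sf x)).
  by move=> a x y; apply: smod_incl_inj; rewrite [RHS]linearP; apply: linearP.
by exists (mklin lf) => x; rewrite mklinE.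
Qed.

Lemma bij_linear_inv (f : {linear M -> N}) : bijective f ->
  exists g : {linear N -> M}, cancel f g /\ cancel g f.
Proof.
case=> g fK gK.
have lg : linear g by move=> a x y; apply: (can_inj fK); rewrite linearP !gK.
by exists (mklin lg).
Qed.

End LinearMaps.

Section Factor.
Variables (R : pzRingType) (X M N : lmodType R).

(** The isomorphism theorem M = X / ker p, in a form that avoids quotients. *)
Lemma factor_surj (p : {linear X -> M}) (f : {linear X -> N}) :
  (forall y, exists x, p x = y) -> (forall x, p x = 0 -> f x = 0) ->
  exists g : {linear M -> N}, forall x, g (p x) = f x.
Proof.
move=> surj ker.
have kerE x y : p x = p y -> f x = f y.
  move/eqP; rewrite -subr_eq0 -raddfB => /eqP/ker/eqP.
  by rewrite raddfB subr_eq0 => /eqP.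
pose s y := sval (cid (surj y)).
have sK y : p (s y) = y by rewrite /s; case: cid.
have lg : linear (f \o s).
  by move=> a x y /=; rewrite -linearP; apply: kerE; rewrite linearP !sK.
by exists (mklin lg) => x; apply: kerE; rewrite sK.
Qed.

End Factor.

Section Image.
Variables (R : pzRingType) (X : lmodType R).

Definition image_sub (Y : lmodType R) (f : {linear X -> Y}) : submodule Y.
Proof.
exists (fun y => exists x, f x = y).
- by exists 0; rewrite raddf0.
- by move=> _ _ [x <-] [y <-]; exists (x + y); rewrite raddfD.
- by move=> a _ [x <-]; exists (a *: x); rewrite linearZ.
Defined.

Definition ker_sub (Y : lmodType R) (f : {linear X -> Y}) : submodule X.
Proof.
exists (fun x => f x = 0).
- by rewrite raddf0.
- by move=> x y fx fy; rewrite linearD fx fy addr0.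
- by move=> a x fx; rewrite linearZ_LR fx scaler0.
Defined.

Lemma image_factor (Y : lmodType R) (f : {linear X -> Y}) :
  exists g : {linear X -> smod (image_sub f)},
    (forall x, smod_incl (g x) = f x) /\ forall y, exists x, g x = y.
Proof.
have [|g gE] := @corestrict _ _ _ (image_sub f) f; first by move=> x; exists x.
exists g; split=> // y; have [x xy] := smod_inclP y.
by exists x; apply: smod_incl_inj; rewrite gE.
Qed.

(** Extension along a map u that need not be injective, only along its image:
this is how injective modules are applied to the terms of a complex. *)
Lemma injective_ext (M N : lmodType R) (u : {linear X -> M}) (f : {linear X -> N}) :
  injective_mod N -> (forall x, u x = 0 -> f x = 0) ->
  exists g : {linear M -> N}, forall x, g (u x) = f x.
Proof.
move=> injN ker; have [p [pE psurj]] := image_factor u.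
have [|f' f'E] := factor_surj (f := f) psurj.
  by move=> x px0; apply: ker; rewrite -pE px0 raddf0.
have [g gE] := injN _ _ (@smod_incl R M (image_sub u)) f' (@smod_incl_inj _ _ _).
by exists g => x; rewrite -pE gE f'E.
Qed.

End Image.

(** * Additive categories of modules *)

(** A copy of the type of linear maps that carries its group structure. *)
Definition LHom (R : pzRingType) (M N : lmodType R) : Type := {linear M -> N}.

Definition lin_of_LHom (R : pzRingType) (M N : lmodType R) (f : LHom M N) :
  {linear M -> N} := f.
Coercion lin_of_LHom : LHom >-> GRing.Linear.type.

Section HomGroup.
Variables (R : pzRingType) (M N : lmodType R).

HB.instance Definition _ := gen_eqMixin (LHom M N).
HB.instance Definition _ := gen_choiceMixin (LHom M N).

Lemma HomP (f g : LHom M N) : f =1 g -> f = g.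
Proof. exact: linear_ext. Qed.

Definition Hom_zero : LHom M N := (\0 : {linear M -> N}).
Definition Hom_opp (f : LHom M N) : LHom M N := (\- f : {linear M -> N}).
Definition Hom_add (f g : LHom M N) : LHom M N := (f \+ g : {linear M -> N}).
Fact Hom_addA : associative Hom_add.
Proof. by move=> f g h; apply: HomP => x /=; rewrite addrA. Qed.
Fact Hom_addC : commutative Hom_add.
Proof. by move=> f g; apply: HomP => x /=; rewrite addrC. Qed.
Fact Hom_add0 : left_id Hom_zero Hom_add.
Proof. by move=> f; apply: HomP => x /=; rewrite add0r. Qed.
Fact Hom_addN : left_inverse Hom_zero Hom_opp Hom_add.
Proof. by move=> f; apply: HomP => x /=; rewrite addNr. Qed.
HB.instance Definition _ := GRing.isZmodule.Build (LHom M N)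
  Hom_addA Hom_addC Hom_add0 Hom_addN.

Lemma HomDE (f g : LHom M N) x : (f + g) x = f x + g x. Proof. by []. Qed.
Lemma Hom0E x : (0 : LHom M N) x = 0. Proof. by []. Qed.
Lemma Hom_sumE I r (P : pred I) (F : I -> LHom M N) x :
  (\sum_(i <- r | P i) F i) x = \sum_(i <- r | P i) F i x.
Proof. exact: (big_morph (fun f : LHom M N => f x)). Qed.

End HomGroup.

Definition hid (R : pzRingType) (M : lmodType R) : LHom M M :=
  (idfun : {linear M -> M}).
Definition hcomp (R : pzRingType) (M N P : lmodType R)
    (g : LHom N P) (f : LHom M N) : LHom M P := (g \o f : {linear M -> P}).
Infix "\oh" := hcomp (at level 40, left associativity).

Definition sub_incl (R : pzRingType) (M : lmodType R) (S : submodule M) :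
  LHom (smod S) M := (@smod_incl _ _ S : {linear smod S -> M}).

Section HomComposition.
Variable R : pzRingType.
Implicit Types M N P Q : lmodType R.

Lemma hcompE M N P (g : LHom N P) (f : LHom M N) x : (g \oh f) x = g (f x).
Proof. by []. Qed.

Lemma hidE M x : hid M x = x. Proof. by []. Qed.

Lemma hcompA M N P Q (h : LHom P Q) (g : LHom N P) (f : LHom M N) :
  h \oh (g \oh f) = h \oh g \oh f.
Proof. exact: HomP. Qed.

Lemma hcomp1f M N (f : LHom M N) : hid N \oh f = f.
Proof. exact: HomP. Qed.

Lemma hcompf1 M N (f : LHom M N) : f \oh hid M = f.
Proof. exact: HomP. Qed.

Lemma hcompDl M N P (g h : LHom N P) (f : LHom M N) :
  (g + h) \oh f = g \oh f + h \oh f.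
Proof. exact: HomP. Qed.

Lemma hcompDr M N P (h : LHom N P) (f g : LHom M N) :
  h \oh (f + g) = h \oh f + h \oh g.
Proof. by apply: HomP => x; rewrite hcompE !HomDE raddfD. Qed.

Lemma hcomp0f M N P (f : LHom M N) : (0 : LHom N P) \oh f = 0.
Proof. exact: HomP. Qed.

Lemma hcompf0 M N P (g : LHom N P) : g \oh (0 : LHom M N) = 0.
Proof. by apply: HomP => x; rewrite hcompE !Hom0E raddf0. Qed.

Lemma hcomp_suml M N P I r (B : pred I) (F : I -> LHom N P) (f : LHom M N) :
  (\sum_(i <- r | B i) F i) \oh f = \sum_(i <- r | B i) F i \oh f.
Proof.
by apply: (big_morph (fun g => g \oh f)) => [g h|]; rewrite (hcompDl, hcomp0f).
Qed.

Lemma hcomp_sumr M N P I r (B : pred I) (g : LHom N P) (F : I -> LHom M N) :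
  g \oh (\sum_(i <- r | B i) F i) = \sum_(i <- r | B i) g \oh F i.
Proof.
by apply: (big_morph (fun f => g \oh f)) => [f h|]; rewrite (hcompDr, hcompf0).
Qed.

(** M belongs to add(N). Unlike a decomposition of a power of N, this equational
form is preserved by any additive functor. *)
Definition summand_of M N : Prop :=
  exists n (a : 'I_n -> LHom M N) (b : 'I_n -> LHom N M),
    \sum_i b i \oh a i = hid M.

Lemma retract_summand M N (a : LHom M N) (b : LHom N M) :
  b \oh a = hid M -> summand_of M N.
Proof.
by move=> ba; exists 1%N, (fun=> a), (fun=> b); rewrite big_ord1.
Qed.

Lemma summand_refl M : summand_of M M.
Proof. by apply: (@retract_summand _ _ (hid M) (hid M)); apply: HomP. Qed.

Lemma summand_trans M N P : summand_of M N -> summand_of N P -> summand_of M P.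
Proof.
move=> [m [a [b ba]]] [n [c [d dc]]].
pose J : finType := ('I_m * 'I_n)%type.
pose h : 'I_#|J| -> J := enum_val.
have hb : bijective h by apply: enum_val_bij.
exists #|J|, (fun i => c (h i).2 \oh a (h i).1),
  (fun i => b (h i).1 \oh d (h i).2).
transitivity (\sum_(j : J) (b j.1 \oh d j.2) \oh (c j.2 \oh a j.1)).
  by rewrite (reindex h) //; apply: onW_bij.
rewrite -ba -(pair_big predT predT
  (fun i j => (b i \oh d j) \oh (c j \oh a i))) /=.
apply: eq_bigr => i _.
rewrite -[in RHS](hcompf1 (b i)) -dc hcomp_sumr hcomp_suml.
by apply: eq_bigr => j _; rewrite !hcompA.
Qed.

(** From right to left, the complement of M in the power of N is the kernel of
the retraction onto M. *)
Lemma in_addP M N : in_add N M <-> summand_of M N.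
Proof.
split=> [[n [C [f /bij_linear_inv[g [fK gK]]]]] | [n [a [b ba]]]].
  pose inj (i : 'I_n) (y : N) : {ffun 'I_n -> N} :=
    [ffun j => if j == i then y else 0].
  have lp i : linear (fun x : M => f (x, 0) i).
    move=> c x y; have -> : (c *: x + y, 0) = c *: (x, 0) + (y, 0) :> (M * C)%type.
      by congr (_, _); rewrite /= ?scaler0 ?addr0.
    by rewrite linearP !ffunE.
  have li i : linear (fun y : N => (g (inj i y)).1).
    move=> c x y; have -> : inj i (c *: x + y) = c *: inj i x + inj i y.
      by apply/ffunP => j; rewrite !ffunE; case: eqP; rewrite // scaler0 addr0.
    by rewrite linearP.
  exists n, (fun i => mklin (lp i)), (fun i => mklin (li i)); apply: HomP => x.
  rewrite Hom_sumE.
  transitivity (\sum_i g (inj i (f (x, 0) i))).1.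
    by elim/big_rec2: _ => //= i y1 y2 _ ->.
  rewrite -raddf_sum.
  suff -> : \sum_i inj i (f (x, 0) i) = f (x, 0).
    exact: (congr1 fst (fK (x, 0))).
  apply/ffunP => j; rewrite sum_ffunE (bigD1 j) //= ffunE eqxx big1 ?addr0 // => i.
  by rewrite ffunE eq_sym => /negPf->.
pose A (x : M) : {ffun 'I_n -> N} := [ffun i => a i x].
pose B (z : {ffun 'I_n -> N}) : M := \sum_i b i (z i).
have lA : linear A by move=> c x y; apply/ffunP => i; rewrite !ffunE linearP.
have lB : linear B.
  move=> c x y; rewrite /B scaler_sumr -big_split; apply: eq_bigr => i _.
  by rewrite !ffunE linearP.
pose Bl := mklin lB.
have AK x : Bl (A x) = x.
  rewrite -[RHS](hidE x) -ba Hom_sumE; apply: eq_bigr => i _.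
  by rewrite ffunE.
pose K := ker_sub Bl.
have lF : linear (fun p : M * smod K => A p.1 + smod_incl p.2).
  move=> c x y; rewrite lA linearP scalerDr !addrA; congr (_ + _).
  by rewrite addrAC.
exists n, (smod K), (mklin lF).
have KP z : smem K (z - A (Bl z)).
  by rewrite -[smem _ _]/(Bl _ = 0) linearB AK subrr.
exists (fun z => (Bl z, smk (KP z))) => [[x k]|z]; last first.
  by rewrite mklinE smkK addrC subrK.
have Bk : Bl (smod_incl k) = 0 by apply: (smod_inclP k).
have BE : Bl (mklin lF (x, k)) = x by rewrite mklinE linearD AK Bk addr0.
congr (_, _); rewrite ?BE //; apply: smod_incl_inj.
by rewrite smkK BE mklinE addrC addKr.
Qed.

End HomComposition.

(** * Equivalences of module categories *)

Section Regular.
Variable R : pzRingType.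
Implicit Types M N : lmodType R.

Definition reg : lmodType R := R^o.

Fact elt_map_linear M (x : M) : linear (fun a : reg => (a : R) *: x).
Proof. by move=> c a b; rewrite scalerDl scalerA. Qed.

Definition elt_map M (x : M) : LHom reg M := mklin (elt_map_linear x).

Lemma elt_mapE M (x : M) (a : R) : elt_map x (a : reg) = a *: x.
Proof. by []. Qed.

Lemma elt_map1 M (x : M) : elt_map x (1 : R) = x.
Proof. by rewrite elt_mapE scale1r. Qed.

Lemma reg_scale1 (a : reg) : (a : R) *: (1 : reg) = a.
Proof. exact: mulr1. Qed.

Lemma reg_homE M (f : LHom reg M) (a : reg) : f a = (a : R) *: f (1 : R).
Proof. by rewrite -[in LHS](reg_scale1 a) linearZ_LR. Qed.

Lemma reg_hom_ext M (f g : LHom reg M) : f (1 : R) = g (1 : R) -> f = g.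
Proof.
by move=> fg1; apply: HomP => a; rewrite !(reg_homE _ a) fg1.
Qed.

Lemma comp_elt_map M N (f : LHom M N) (x : M) : f \oh elt_map x = elt_map (f x).
Proof. by apply: reg_hom_ext; rewrite hcompE !elt_map1. Qed.

Lemma hom_bij_inv M N (f : LHom M N) :
  injective f -> (forall y, exists x, f x = y) ->
  exists g : LHom N M, g \oh f = hid M /\ f \oh g = hid N.
Proof.
move=> finj fsurj; have [|g [fK gK]] := @bij_linear_inv _ _ _ f.
  exists (fun y => sval (cid (fsurj y))) => [x|y]; last by case: cid.
  by case: cid => z /= /finj.
by exists g; split; apply: HomP => x; rewrite hcompE (fK, gK).
Qed.

End Regular.

Section FunctorMaps.
Variables (R S : pzRingType) (F : mod_functor R S).
Implicit Types M N P : rmodType R.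

Definition hmap M N (f : LHom M N) : LHom (F M) (F N) := fmap F f.

Lemma hmap_id M : hmap (hid M) = hid (F M).
Proof. exact/HomP/fmap_id. Qed.

Lemma hmap_comp M N P (g : LHom N P) (f : LHom M N) :
  hmap (g \oh f) = hmap g \oh hmap f.
Proof. exact/HomP/fmap_comp. Qed.

End FunctorMaps.

Definition inverse_functors (R S : pzRingType)
    (F : mod_functor R S) (H : mod_functor S R) : Prop :=
  nat_isomorphic (comp_functor H F) (id_functor R) /\
  nat_isomorphic (comp_functor F H) (id_functor S).

Lemma inverse_functors_sym (R S : pzRingType)
    (F : mod_functor R S) (H : mod_functor S R) :
  inverse_functors F H -> inverse_functors H F.
Proof. by case. Qed.

Section Equivalence.
Variables (R S : pzRingType) (F : mod_functor R S) (H : mod_functor S R).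
Hypothesis FH : inverse_functors F H.
Implicit Types M N P : rmodType R.

Lemma equiv_unit : exists (u : forall M, LHom (H (F M)) M)
    (v : forall M, LHom M (H (F M))),
  [/\ forall M, v M \oh u M = hid _, forall M, u M \oh v M = hid _ &
    forall M N (f : LHom M N), u N \oh hmap H (hmap F f) = f \oh u M].
Proof.
case: FH => -[eta [eta_bij eta_nat]] _.
pose inv M := cid (bij_linear_inv (eta_bij M)).
exists eta, (fun M => sval (inv M)); split=> [M|M|M N f]; last first.
- by apply: HomP => x; apply: (eta_nat _ _ f).
- by case: (inv M) => g [fK gK]; apply: HomP => x; rewrite hcompE gK.
- by case: (inv M) => g [fK gK]; apply: HomP => x; rewrite hcompE fK.
Qed.

Lemma equiv_faithful M N (f g : LHom M N) : hmap F f = hmap F g -> f = g.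
Proof.
have [u [v [vu uv nat]]] := equiv_unit => fg.
by rewrite -[f]hcompf1 -[g]hcompf1 -uv !hcompA -!nat fg.
Qed.

End Equivalence.

Section EquivalenceFull.
Variables (R S : pzRingType) (F : mod_functor R S) (H : mod_functor S R).
Hypothesis FH : inverse_functors F H.
Implicit Types M N P : rmodType R.

Lemma equiv_full M N (h : LHom (F M) (F N)) : exists f, hmap F f = h.
Proof.
have [u [v [vu uv nat]]] := equiv_unit FH.
exists (u N \oh hmap H h \oh v M).
apply: (equiv_faithful (inverse_functors_sym FH)).
rewrite -[LHS]hcomp1f -vu -hcompA nat -!hcompA vu hcompf1.
by rewrite !hcompA vu hcomp1f.
Qed.

Lemma equiv_map0 M N : hmap F (0 : LHom M N) = 0.
Proof.
have [g g0] := equiv_full (0 : LHom (F M) (F M)).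
by rewrite -(hcomp0f N g) hmap_comp g0 hcompf0.
Qed.

(** The functors are not assumed additive. Addition of maps is determined by
biproducts, f + g = (p1 + p2) o (i1 f + i2 g), and these are preserved because
the identity of N * N is the only endomorphism compatible with both
projections. *)
Lemma equiv_mapD M N (f g : LHom M N) : hmap F (f + g) = hmap F f + hmap F g.
Proof.
have lp1 : linear (fun p : N * N => p.1) by [].
have lp2 : linear (fun p : N * N => p.2) by [].
have li1 : linear (fun x : N => (x, 0) : N * N).
  by move=> c x y; congr (_, _); rewrite /= scaler0 addr0.
have li2 : linear (fun x : N => (0, x) : N * N).
  by move=> c x y; congr (_, _); rewrite /= scaler0 addr0.
pose p1 : LHom (N * N)%type N := mklin lp1.
pose p2 : LHom (N * N)%type N := mklin lp2.
pose i1 : LHom N (N * N)%type := mklin li1.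
pose i2 : LHom N (N * N)%type := mklin li2.
have p1i1 : p1 \oh i1 = hid N by apply: HomP.
have p1i2 : p1 \oh i2 = 0 by apply: HomP.
have p2i1 : p2 \oh i1 = 0 by apply: HomP.
have p2i2 : p2 \oh i2 = hid N by apply: HomP.
have w1 : hmap F i1 \oh hmap F p1 + hmap F i2 \oh hmap F p2 = hid _.
  have [w wE] := equiv_full (hmap F i1 \oh hmap F p1 + hmap F i2 \oh hmap F p2).
  suff w1 : w = hid _ by rewrite -wE w1 hmap_id.
  have p1w : p1 \oh w = p1.
    apply: (equiv_faithful FH); rewrite hmap_comp wE hcompDr !hcompA -!hmap_comp.
    by rewrite p1i1 p1i2 hcomp1f hcomp0f equiv_map0 addr0.
  have p2w : p2 \oh w = p2.
    apply: (equiv_faithful FH); rewrite hmap_comp wE hcompDr !hcompA -!hmap_comp.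
    by rewrite p2i1 p2i2 hcomp1f hcomp0f equiv_map0 add0r.
  apply: HomP => x; rewrite [RHS]surjective_pairing [LHS]surjective_pairing.
  by rewrite -[_.1]/((p1 \oh w) x) -[_.2]/((p2 \oh w) x) p1w p2w.
have fgE : f + g = (p1 + p2) \oh (i1 \oh f + i2 \oh g).
  rewrite hcompDl !hcompDr !hcompA p1i1 p1i2 p2i1 p2i2.
  by rewrite !hcomp1f !hcomp0f addr0 add0r.
have sE : hmap F (p1 + p2) = hmap F p1 + hmap F p2.
  rewrite -[LHS]hcompf1 -w1 hcompDr !hcompA -!hmap_comp !hcompDl.
  by rewrite p1i1 p1i2 p2i1 p2i2 !hcomp1f !hcomp0f addr0 add0r.
rewrite fgE hmap_comp sE hcompDl -!hmap_comp !hcompDr !hcompA.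
by rewrite p1i1 p1i2 p2i1 p2i2 !hcomp1f !hcomp0f addr0 add0r.
Qed.

Lemma equiv_map_sum M N n (f : 'I_n -> LHom M N) :
  hmap F (\sum_i f i) = \sum_i hmap F (f i).
Proof. exact: (big_morph (@hmap _ _ F M N) (@equiv_mapD M N) (@equiv_map0 M N)). Qed.

Lemma equiv_summand M N : summand_of M N -> summand_of (F M) (F N).
Proof.
move=> [n [a [b ba]]]; exists n, (fun i => hmap F (a i)), (fun i => hmap F (b i)).
by rewrite -hmap_id -ba equiv_map_sum; apply: eq_bigr => i _; rewrite hmap_comp.
Qed.

Lemma equiv_reflect_iso M N (f : LHom M N) (g : LHom (F N) (F M)) :
  g \oh hmap F f = hid _ -> hmap F f \oh g = hid _ ->
  exists f', f' \oh f = hid M /\ f \oh f' = hid N.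
Proof.
have [f' <-] := equiv_full g; rewrite -!hmap_comp => gf fg; exists f'.
by split; apply: (equiv_faithful FH); rewrite hmap_id.
Qed.

End EquivalenceFull.

Section EquivalenceGenerator.
Variables (R S : pzRingType) (F : mod_functor R S) (H : mod_functor S R).
Hypothesis FH : inverse_functors F H.
Let HF := inverse_functors_sym FH.

(** An element of F(M) is a map from the regular module, which is the image of
some module because F is essentially surjective; so injectivity of F(f) can be
tested on maps in the image of F. *)
Lemma equiv_inj (M N : rmodType R) (f : LHom M N) :
  injective f -> injective (hmap F f).
Proof.
move=> finj; apply: linear_inj0 => x fx0.
have [u [v [vu uv _]]] := equiv_unit HF.
have [h hE] := equiv_full FH (elt_map x \oh u (reg S^c)).
have h0 : h = 0.
  apply: HomP => y; apply: finj; rewrite Hom0E raddf0 -hcompE.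
  suff -> : f \oh h = 0 by [].
  apply: (equiv_faithful FH); rewrite hmap_comp hE hcompA comp_elt_map fx0.
  rewrite (equiv_map0 FH) -(hcomp0f _ (u (reg S^c))); congr (_ \oh _).
  by apply: reg_hom_ext; rewrite elt_map1 Hom0E.
have : elt_map x = 0.
  by rewrite -[elt_map x]hcompf1 -uv hcompA -hE h0 (equiv_map0 FH) hcomp0f.
by move=> /(congr1 (fun k : LHom (reg S^c) (F M) => k (1 : S))); rewrite elt_map1.
Qed.

End EquivalenceGenerator.

Section TraceIdeal.
Variables (R : pzRingType) (P M : lmodType R).

(** The trace of P in M: the sum of the images of all maps from P to M. *)
Definition trace_sub : submodule M.
Proof.
exists (fun s => exists n (f : 'I_n -> LHom P M)
  (x : 'I_n -> P), s = \sum_i f i (x i)).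
- by exists 0%N, (fun=> 0), (fun=> 0); rewrite big_ord0.
- move=> _ _ [m [f [x ->]]] [n [g [y ->]]].
  exists (m + n)%N, (fun i => match split i with inl j => f j | inr j => g j end),
    (fun i => match split i with inl j => x j | inr j => y j end).
  rewrite big_split_ord; congr (_ + _); apply: eq_bigr => i _.
    by rewrite (unsplitK (inl _ i)).
  by rewrite (unsplitK (inr _ i)).
- move=> a _ [n [f [x ->]]]; exists n, f, (fun i => a *: x i).
  by rewrite scaler_sumr; apply: eq_bigr => i _; rewrite linearZ_LR.
Defined.

Lemma trace_factor (f : LHom P M) :
  exists g : LHom P (smod trace_sub), f = sub_incl trace_sub \oh g.
Proof.
have [|g gE] := @corestrict _ _ _ trace_sub f.
  by move=> x; exists 1%N, (fun=> f), (fun=> x); rewrite big_ord1.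
by exists g; apply: HomP => x; rewrite hcompE -[LHS]gE.
Qed.

End TraceIdeal.

Section EquivalenceRegular.
Variables (R S : pzRingType) (F : mod_functor R S) (H : mod_functor S R).
Hypothesis FH : inverse_functors F H.
Let HF := inverse_functors_sym FH.

(** F(R) is a generator: let I be the trace of F(R) in S and H a quasi-inverse of
F. Every map F(R) -> S factors through I, so every map R -> H(S) factors
through H(I), and H(I) -> H(S) is onto. It is also injective, hence invertible,
and so is the inclusion of I in S; thus 1 lies in the trace. *)
Lemma equiv_generator : summand_of (reg S^c) (F (reg R^c)).
Proof.
set P := F (reg R^c); pose I := trace_sub P (reg S^c).
have [u [v [vu uv _]]] := equiv_unit FH.
have inj_incl : injective (sub_incl I) by apply: smod_incl_inj.
have [|g [gi ig]] := hom_bij_inv (equiv_inj HF inj_incl).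
  move=> y; have [f fE] := equiv_full HF (elt_map y \oh u (reg R^c)).
  have [f0 f0E] := trace_factor f.
  exists (hmap H f0 (v (reg R^c) (1 : R))).
  transitivity ((hmap H (sub_incl I) \oh hmap H f0 \oh v _) (1 : R)) => //.
  by rewrite -hmap_comp -f0E fE -hcompA uv hcompf1 elt_map1.
have [j [_ ij]] := equiv_reflect_iso HF gi ig.
have [n [f [x xE]]] := smod_inclP (j (1 : S)).
exists n, (fun i => elt_map (x i)), f; apply: reg_hom_ext.
rewrite Hom_sumE -[RHS]/(hid (reg S^c) _) -ij; rewrite [RHS]xE.
by apply: eq_bigr => i _; rewrite hcompE elt_map1.
Qed.

End EquivalenceRegular.

(** R is a summand of a power of H(S); apply the additive functor F. *)
Lemma equiv_reg_summand (R S : pzRingType)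
    (F : mod_functor R S) (H : mod_functor S R) :
  inverse_functors F H -> summand_of (F (reg R^c)) (reg S^c).
Proof.
move=> FH; have HF := inverse_functors_sym FH.
have [u [v [vu uv _]]] := equiv_unit HF.
apply: summand_trans (equiv_summand FH (equiv_generator HF)) _.
exact: retract_summand (vu _).
Qed.

(** * Sources of Morita equivalences *)

Lemma Morita_sym (R S : pzRingType) :
  Morita_equivalent R S -> Morita_equivalent S R.
Proof. by move=> [F [H [FH HF]]]; exists H, F. Qed.

Lemma nat_iso_comp (R S T : pzRingType) (F1 : mod_functor R S)
    (H1 : mod_functor S R) (F2 : mod_functor S T) (H2 : mod_functor T S) :
  nat_isomorphic (comp_functor H1 F1) (id_functor R) ->
  nat_isomorphic (comp_functor H2 F2) (id_functor S) ->
  nat_isomorphic (comp_functor (comp_functor H1 H2) (comp_functor F2 F1))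
    (id_functor R).
Proof.
move=> [e1 [b1 n1]] [e2 [b2 n2]].
exists (fun M : rmodType R => e1 M \o fmap H1 (e2 (F1 M)) : {linear _ -> _}).
split=> [M|M N f x] /=.
  apply: bij_comp (b1 M) _; have [g [gK Kg]] := bij_linear_inv (b2 (F1 M)).
  exists (fmap H1 g) => x.
    rewrite -[LHS](@fmap_comp _ _ H1) -[RHS](@fmap_id _ _ H1).
    by congr (fmap H1 _ x); apply: linear_ext => y /=; rewrite gK.
  rewrite -[LHS](@fmap_comp _ _ H1) -[RHS](@fmap_id _ _ H1).
  by congr (fmap H1 _ x); apply: linear_ext => y /=; rewrite Kg.
rewrite -[RHS](n1 _ _ f) /=; congr (e1 N _).
rewrite -[LHS](@fmap_comp _ _ H1) -[RHS](@fmap_comp _ _ H1).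
by congr (fmap H1 _ x); apply: linear_ext => y /=; apply: (n2 _ _ (fmap F1 f) y).
Qed.

Lemma Morita_trans (R S T : pzRingType) :
  Morita_equivalent R S -> Morita_equivalent S T -> Morita_equivalent R T.
Proof.
move=> [F1 [H1 [u1 v1]]] [F2 [H2 [u2 v2]]].
exists (comp_functor F2 F1), (comp_functor H1 H2).
by split; apply: nat_iso_comp.
Qed.

(** The ring morphism is a parameter of the type, so that different restrictions
of the same module can carry different structures. *)
Definition restr (A B : pzRingType) (s : {rmorphism A -> B}) (N : rmodType B) :
  Type := N.

Section Restriction.
Variables (A B : pzRingType) (s : {rmorphism A -> B}).

Section RestrictionObject.
Variable N : rmodType B.

HB.instance Definition _ := GRing.Zmodule.copy (restr s N) N.

Definition restr_scale (a : A^c) (x : restr s N) : restr s N := (s a : B^c) *: (x : N).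
Fact restr_scaleA a b x : restr_scale a (restr_scale b x) = restr_scale (a * b) x.
Proof. by rewrite /restr_scale scalerA -[a * b]/((b : A) * (a : A)) rmorphM. Qed.
Fact restr_scale1 : left_id 1 restr_scale.
Proof. by move=> x; rewrite /restr_scale rmorph1 scale1r. Qed.
Fact restr_scaleDr : right_distributive restr_scale +%R.
Proof. by move=> a x y; rewrite /restr_scale scalerDr. Qed.
Fact restr_scaleDl x : {morph restr_scale^~ x : a b / a + b}.
Proof. by move=> a b; rewrite /restr_scale rmorphD scalerDl. Qed.
HB.instance Definition _ := GRing.Zmodule_isLmodule.Build A^c (restr s N)
  restr_scaleA restr_scale1 restr_scaleDr restr_scaleDl.

End RestrictionObject.

Fact restr_map_linear (M N : rmodType B) (f : {linear M -> N}) :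
  linear (f : restr s M -> restr s N).
Proof. by move=> a x y; apply: linearP. Qed.

Definition restr_functor : mod_functor B A :=
  @ModFunctor B A (fun N => restr s N) (fun M N f => mklin (restr_map_linear f))
    (fun M x => erefl) (fun M N P g f x => erefl).

End Restriction.

Lemma restr_cancel (A B : pzRingType) (s : {rmorphism A -> B})
    (t : {rmorphism B -> A}) : cancel s t ->
  nat_isomorphic (comp_functor (restr_functor s) (restr_functor t)) (id_functor A).
Proof.
move=> sK.
have l (M : rmodType A) : linear (id : restr s (restr t M) -> M).
  move=> a x y; congr (_ + _); rewrite -[a in RHS]sK //.
exists (fun M => mklin (l M)); split=> // M; by exists id.
Qed.

Definition ring_iso (A B : pzRingType) : Prop :=
  exists (s : {rmorphism A -> B}) (t : {rmorphism B -> A}), cancel s t /\ cancel t s.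

Lemma ring_iso_Morita (A B : pzRingType) : ring_iso A B -> Morita_equivalent A B.
Proof.
move=> [s [t [sK tK]]]; exists (restr_functor t), (restr_functor s).
by split; apply: restr_cancel.
Qed.

Section HomAsModule.
Variables (R : pzRingType) (X Y : lmodType R).

Definition precomp (a : (End_mod X)^c) (p : LHom X Y) : LHom X Y :=
  p \oh (a : LHom X X).
Fact precompA a b p : precomp a (precomp b p) = precomp (a * b) p.
Proof. exact: HomP. Qed.
Fact precomp1 : left_id 1 precomp.
Proof. by move=> p; apply: HomP. Qed.
Fact precompDr : right_distributive precomp +%R.
Proof. by move=> a p q; apply: HomP. Qed.
Fact precompDl p : {morph precomp^~ p : a b / a + b}.
Proof. by move=> a b; apply: HomP => x; apply: (raddfD (p : {linear _ -> _})). Qed.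
HB.instance Definition _ := GRing.Zmodule_isLmodule.Build (End_mod X)^c (LHom X Y)
  precompA precomp1 precompDr precompDl.

End HomAsModule.

(** The modules P = Hom(X, Y) and Q = Hom(Y, X) form a Morita context between
End(X) and End(Y) under composition. The functor below is Hom(P, -) from right
End(X)-modules to right End(Y)-modules; using Hom(Q, -) as its inverse, instead
of a tensor product with P, makes both directions instances of one
construction. *)
Section ContextFunctor.
Variables (R : pzRingType) (X Y : lmodType R).

Fact postcomp_linear (b : LHom Y Y) : linear (fun p : LHom X Y => b \oh p : LHom X Y).
Proof.
by move=> a p q; apply: HomP => x /=; apply: (raddfD (b : {linear _ -> _})).
Qed.

Definition postcomp (b : LHom Y Y) : LHom (LHom X Y) (LHom X Y) :=
  mklin (postcomp_linear b).

Section ContextObject.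
Variable M : rmodType (End_mod X).

Definition ctx : Type := LHom (LHom X Y : rmodType (End_mod X)) M.
HB.instance Definition _ := GRing.Zmodule.on ctx.

Definition ctx_scale (b : (End_mod Y)^c) (h : ctx) : ctx := h \oh postcomp b.
Fact ctx_scaleA a b h : ctx_scale a (ctx_scale b h) = ctx_scale (a * b) h.
Proof. by apply: HomP => p; apply: (congr1 h); apply: HomP. Qed.
Fact ctx_scale1 : left_id 1 ctx_scale.
Proof. by move=> h; apply: HomP => p; apply: (congr1 h); apply: HomP. Qed.
Fact ctx_scaleDr : right_distributive ctx_scale +%R.
Proof. by move=> a g h; apply: HomP. Qed.
Fact ctx_scaleDl h : {morph ctx_scale^~ h : a b / a + b}.
Proof.
move=> a b; apply: HomP => p.
rewrite -[RHS](raddfD (h : {linear _ -> _})).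
by apply: (congr1 h); apply: HomP.
Qed.
HB.instance Definition _ := GRing.Zmodule_isLmodule.Build (End_mod Y)^c ctx
  ctx_scaleA ctx_scale1 ctx_scaleDr ctx_scaleDl.

End ContextObject.

Fact ctx_map_linear (M N : rmodType (End_mod X)) (f : {linear M -> N}) :
  linear (fun h : ctx M => (f : LHom M N) \oh h : ctx N).
Proof. by move=> a g h; apply: HomP => p; apply: (raddfD f). Qed.

Definition ctx_functor : mod_functor (End_mod X) (End_mod Y).
Proof.
refine (@ModFunctor _ _ (fun M => ctx M)
  (fun M N f => mklin (ctx_map_linear f)) _ _).
  by move=> M h; apply: HomP.
by move=> M N P g f h; apply: HomP.
Defined.

End ContextFunctor.

Section ContextUnit.
Variables (R : pzRingType) (X Y : lmodType R).

Section UnitAt.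
Variable M : rmodType (End_mod X).

Fact ctx_unit_linear_p (m : M) (q : LHom Y X) :
  linear (fun p : LHom X Y => (q \oh p : (End_mod X)^c) *: m).
Proof.
move=> a p p'; rewrite scalerA -scalerDl; congr (_ *: m).
by apply: HomP => x /=; apply: (raddfD (q : {linear _ -> _})).
Qed.

Definition ctx_unit_p (m : M) (q : LHom Y X) : ctx Y M :=
  mklin (@ctx_unit_linear_p m q).

Fact ctx_unit_linear_q (m : M) :
  linear (fun q : LHom Y X => ctx_unit_p m q).
Proof.
move=> b q q'; apply: HomP => p.
transitivity ((q \oh ((b : LHom Y Y) \oh p) : (End_mod X)^c) *: m +
  (q' \oh p : (End_mod X)^c) *: m); last by [].
by rewrite -scalerDl /ctx_unit_p mklinE; congr (_ *: m); apply: HomP.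
Qed.

Definition ctx_unit_q (m : M) : ctx X (ctx Y M) := mklin (@ctx_unit_linear_q m).

Lemma ctx_unit_qE m q p : ctx_unit_q m q p = (q \oh p : (End_mod X)^c) *: m.
Proof. by []. Qed.

Fact ctx_unit_linear : linear ctx_unit_q.
Proof.
move=> a m m'; apply: HomP => q; apply: HomP => p.
rewrite !HomDE !ctx_unit_qE scalerDr scalerA; congr (_ + _).
by congr (_ *: m); apply: HomP.
Qed.

Definition ctx_unit : LHom M (ctx X (ctx Y M)) := mklin ctx_unit_linear.

(** The unit sends m to the map q |-> (p |-> m . (q p)). If b_i, a_i present X as
a summand of a power of Y, so that the sum of the b_i a_i is 1, its inverse is
h |-> sum of the h(b_i)(a_i). *)
Lemma ctx_unit_bij : summand_of X Y -> bijective ctx_unit.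
Proof.
move=> [n [a [b ba]]].
exists (fun h : ctx X (ctx Y M) => \sum_i h (b i) (a i)) => [m|h].
  rewrite -[RHS]scale1r -scaler_suml; congr (_ *: m).
  by rewrite -[RHS]/(hid X) -ba.
apply: HomP => q; apply: HomP => p; rewrite ctx_unit_qE scaler_sumr.
transitivity (\sum_i h (b i \oh (a i \oh q)) p).
  apply: eq_bigr => i _.
  have -> : b i \oh (a i \oh q) = (a i \oh q : (End_mod Y)^c) *: b i by [].
  rewrite linearZ_LR /= -[LHS](linearZ_LR (h (b i)) (q \oh p : (End_mod X)^c)).
  by apply: (congr1 (h (b i))); apply: HomP.
rewrite -Hom_sumE -raddf_sum; congr (h _ p).
rewrite -[RHS]hcomp1f -ba hcomp_suml.
by apply: eq_bigr => i _; rewrite hcompA.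
Qed.

End UnitAt.

Lemma ctx_unit_natural (M N : rmodType (End_mod X)) (f : {linear M -> N}) :
  ctx_unit N \o f =1
  fmap (comp_functor (ctx_functor Y X) (ctx_functor X Y)) f \o ctx_unit M.
Proof.
move=> m; apply: HomP => q; apply: HomP => p /=.
by symmetry; apply: (linearZ_LR f).
Qed.

End ContextUnit.

Lemma nat_iso_inv (R S : pzRingType) (F G : mod_functor R S) :
  nat_isomorphic F G -> nat_isomorphic G F.
Proof.
move=> [e [b nat]]; pose inv M := cid (bij_linear_inv (b M)).
exists (fun M => sval (inv M)); split=> [M|M N f x].
  by case: (inv M) => g [gK Kg] /=; exists (e M).
case: (inv M) => g [gK Kg]; case: (inv N) => h [hK Kh] /=.
by apply: (can_inj hK); rewrite Kh [RHS](nat _ _ f) /= Kg.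
Qed.

Lemma ctx_equiv (R : pzRingType) (X Y : lmodType R) : summand_of X Y ->
  nat_isomorphic (comp_functor (ctx_functor Y X) (ctx_functor X Y))
    (id_functor (End_mod X)).
Proof.
move=> XY; apply: nat_iso_inv; exists (@ctx_unit R X Y); split=> [M|M N f].
  exact: ctx_unit_bij.
exact: ctx_unit_natural.
Qed.

Lemma End_Morita (R : pzRingType) (X Y : lmodType R) :
  summand_of X Y -> summand_of Y X -> Morita_equivalent (End_mod X) (End_mod Y).
Proof.
by move=> XY YX; exists (ctx_functor X Y), (ctx_functor Y X); split;
  apply: ctx_equiv.
Qed.

(** * Transport along an isomorphism of endomorphism rings *)

(** A ring isomorphism End(X) -> End(Y), stated with composition of maps so that
it can be mixed with maps between different modules. *)
Record end_iso (R S : pzRingType) (X : lmodType R) (Y : lmodType S) := EndIso {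
  end_map :> LHom X X -> LHom Y Y;
  end_inv : LHom Y Y -> LHom X X;
  end_mapK : cancel end_map end_inv;
  end_invK : cancel end_inv end_map;
  end_mapD : {morph end_map : f g / f + g};
  end_mapM : {morph end_map : f g / f \oh g};
  end_map1 : end_map (hid X) = hid Y
}.

Section EndIso.
Variables (R S : pzRingType) (X : lmodType R) (Y : lmodType S).

Definition end_iso_sym (s : end_iso X Y) : end_iso Y X.
Proof.
refine (@EndIso _ _ Y X (end_inv s) s (end_invK s) (end_mapK s) _ _ _).
- by move=> f g; apply: (can_inj (end_mapK s)); rewrite end_mapD !end_invK.
- by move=> f g; apply: (can_inj (end_mapK s)); rewrite end_mapM !end_invK.
- by apply: (can_inj (end_mapK s)); rewrite end_map1 !end_invK.
Defined.

Variable s : end_iso X Y.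

Lemma end_map0 : s 0 = 0.
Proof. by apply: (addIr (s 0)); rewrite -end_mapD !add0r. Qed.

Lemma end_map_sum n (f : 'I_n -> LHom X X) : s (\sum_i f i) = \sum_i s (f i).
Proof. exact: (big_morph _ (end_mapD s) end_map0). Qed.

Lemma end_iso_rmorphism : exists f : {rmorphism End_mod X -> End_mod Y}, f =1 s.
Proof.
have sB : zmod_morphism (s : End_mod X -> End_mod Y).
  move=> f g; apply: (addIr (s g : End_mod Y)); rewrite subrK.
  rewrite -[LHS](end_mapD s (f - g : End_mod X) g).
  by rewrite -[X in s X]/((f - g) + g : End_mod X) subrK.
have sM : monoid_morphism (s : End_mod X -> End_mod Y).
  by split=> [|f g]; [apply: end_map1 | apply: end_mapM].
pose f : {rmorphism End_mod X -> End_mod Y} :=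
  HB.pack (s : End_mod X -> End_mod Y)
    (GRing.isZmodMorphism.Build (End_mod X) (End_mod Y) s sB)
    (GRing.isMonoidMorphism.Build (End_mod X) (End_mod Y) s sM).
by exists f.
Qed.

End EndIso.

Definition end_iso_trans (R S T : pzRingType) (X : lmodType R) (Y : lmodType S)
    (Z : lmodType T) : end_iso X Y -> end_iso Y Z -> end_iso X Z.
Proof.
move=> s t.
refine (@EndIso _ _ _ _ (t \o s) (end_inv s \o end_inv t) _ _ _ _ _).
- by move=> f /=; rewrite !end_mapK.
- by move=> f /=; rewrite !end_invK.
- by move=> f g /=; rewrite !end_mapD.
- by move=> f g /=; rewrite !end_mapM.
- by rewrite /= !end_map1.
Defined.

Lemma end_iso_ring_iso (R S : pzRingType) (X : lmodType R) (Y : lmodType S) :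
  end_iso X Y -> ring_iso (End_mod X) (End_mod Y).
Proof.
move=> s; have [f fE] := end_iso_rmorphism s.
have [g gE] := end_iso_rmorphism (end_iso_sym s).
exists f, g; split=> x; rewrite fE gE; [exact: end_mapK | exact: end_invK].
Qed.

Lemma reg_end_ring_iso (A : pzRingType) : ring_iso A (End_mod (reg A^c)).
Proof.
pose s (a : A) : End_mod (reg A^c) := elt_map (a : reg A^c).
pose t (f : End_mod (reg A^c)) : A := (f : LHom _ _) (1 : A).
have tE f b : (f : LHom _ _) b = t f * b by rewrite (reg_homE f b).
have sB : zmod_morphism s.
  move=> a b; apply: End_modP => x.
  exact: (scalerBr (x : A^c) (a : reg A^c) (b : reg A^c)).
have sM : monoid_morphism s.
  split; first by apply: End_modP => x; exact: (mul1r (x : A)).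
  by move=> a b; apply: End_modP => x; exact: (esym (mulrA (a : A) b (x : A))).
have tB : zmod_morphism t by [].
have tM : monoid_morphism t by split=> // f g; apply: (tE f (t g)).
pose s' : {rmorphism A -> End_mod (reg A^c)} :=
  HB.pack s (GRing.isZmodMorphism.Build A (End_mod (reg A^c)) s sB)
    (GRing.isMonoidMorphism.Build A (End_mod (reg A^c)) s sM).
pose t' : {rmorphism End_mod (reg A^c) -> A} :=
  HB.pack t (GRing.isZmodMorphism.Build (End_mod (reg A^c)) A t tB)
    (GRing.isMonoidMorphism.Build (End_mod (reg A^c)) A t tM).
exists s', t'; split=> [a|f]; first exact: mulr1.
by apply: End_modP => x; exact: (esym (tE f x)).
Qed.

Definition reg_end_iso (R : pzRingType) (X : lmodType R) :
  end_iso (reg (End_mod X)^c) X.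
Proof.
pose A := End_mod X.
refine (@EndIso _ _ (reg A^c) X (fun f => f (1 : A)) (fun a => elt_map (a : reg A^c))
  _ _ _ _ _).
- by move=> f; apply: reg_hom_ext; rewrite elt_map1.
- by move=> a; rewrite elt_map1.
- by move=> f g.
- by move=> f g; rewrite hcompE (reg_homE f).
- by [].
Defined.

Section Transport.
Variables (R S : pzRingType) (X : lmodType R) (Y : lmodType S).

(** Z and Z' are the images of idempotent matrices with entries in End(X) and in
End(Y) that correspond to each other under s: the entries are a_i b_j. *)
Record matched (s : end_iso X Y) (Z : lmodType R) (Z' : lmodType S) := Matched {
  msize : nat;
  ma : 'I_msize -> LHom Z X;
  mb : 'I_msize -> LHom X Z;
  ma' : 'I_msize -> LHom Z' Y;
  mb' : 'I_msize -> LHom Y Z';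
  mbaK : \sum_i mb i \oh ma i = hid Z;
  mbaK' : \sum_i mb' i \oh ma' i = hid Z';
  mabE : forall i j, s (ma i \oh mb j) = ma' i \oh mb' j
}.

End Transport.

Arguments ma {R S X Y s Z Z'} m i.
Arguments mb {R S X Y s Z Z'} m i.
Arguments ma' {R S X Y s Z Z'} m i.
Arguments mb' {R S X Y s Z Z'} m i.
Arguments mabE {R S X Y s Z Z'} m i j.

Section Matching.
Variables (R S : pzRingType) (X : lmodType R) (Y : lmodType S).
Variable s : end_iso X Y.

Definition matched_sym Z Z' (m : matched s Z Z') : matched (end_iso_sym s) Z' Z.
Proof.
refine (Matched (mbaK' m) (mbaK m) _).
by move=> i j; rewrite /= -mabE end_mapK.
Defined.

(** Not an instance of matched_sym: inverting s twice gives back its maps, but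
other proofs. *)
Definition matched_unsym Z Z' (m : matched (end_iso_sym s) Z' Z) : matched s Z Z'.
Proof.
refine (Matched (mbaK' m) (mbaK m) _).
by move=> i j; rewrite -mabE end_invK.
Defined.

(** The image of the idempotent matrix s(a_i b_j) acting on a power of Y; the
submodule K consists of its fixed vectors. *)
Lemma matched_exists Z : summand_of Z X -> exists Z', inhabited (matched s Z Z').
Proof.
move=> [n [a [b ba]]].
have lE : linear (fun y : {ffun 'I_n -> Y} =>
    [ffun i => \sum_j s (a i \oh b j) (y j) - y i] : {ffun 'I_n -> Y}).
  move=> c x y; apply/ffunP => i; rewrite ?ffunE scalerBr addrACA -opprD.
  rewrite ?ffunE scaler_sumr -big_split; congr (_ - _); apply: eq_bigr => j _.
  by rewrite ?ffunE linearP.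
pose K := ker_sub (mklin lE); exists (smod K); constructor.
have KP (y : smod K) i : \sum_j s (a i \oh b j) (smod_incl y j) = smod_incl y i.
  have := smod_inclP y; move/ffunP/(_ i); rewrite mklinE !ffunE => /eqP.
  by rewrite subr_eq0 => /eqP.
have la i : linear (fun y : smod K => smod_incl y i) by move=> c x y; rewrite !ffunE.
have lb j : linear (fun y : Y => [ffun i => s (a i \oh b j) y] : {ffun 'I_n -> Y}).
  by move=> c x y; apply/ffunP => i; rewrite !ffunE linearP.
have lbK j y : smem K (mklin (lb j) y).
  have lbE i : mklin (lb j) y i = s (a i \oh b j) y by rewrite mklinE ffunE.
  rewrite -[smem K _]/(mklin lE _ = 0); apply/ffunP => i.
  rewrite [LHS]ffunE [RHS]ffunE lbE.
  apply/eqP; rewrite subr_eq0; apply/eqP.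
  transitivity (s (\sum_k (a i \oh b k) \oh (a k \oh b j)) y).
    rewrite end_map_sum Hom_sumE; apply: eq_bigr => k _.
    by rewrite lbE end_mapM.
  congr (s _ y); rewrite -[in RHS](hcomp1f (b j)) -ba hcomp_suml hcomp_sumr.
  by apply: eq_bigr => k _; rewrite !hcompA.
pose b' j := cid (corestrict (lbK j)).
have b'E j y i : smod_incl (sval (b' j) y) i = s (a i \oh b j) y.
  by case: (b' j) => f fE; rewrite [smod_incl _]fE; apply: ffunE.
refine (@Matched R S X Y s Z (smod K) n a b (fun i => mklin (la i))
  (fun j => sval (b' j)) ba _ _).
  apply: HomP => y; apply: smod_incl_inj; apply/ffunP => i.
  rewrite Hom_sumE -[LHS]/(sub_incl K _ i) raddf_sum sum_ffunE -[RHS]KP.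
  by apply: eq_bigr => j _; apply: b'E.
by move=> i j; apply: HomP => y; rewrite hcompE mklinE b'E.
Qed.

End Matching.

Section TransportMap.
Variables (R S : pzRingType) (X : lmodType R) (Y : lmodType S).
Variable s : end_iso X Y.

(** A map f : Z -> W is the matrix with entries a_i f b_j over End(X); apply s to
the entries. *)
Definition transport Z Z' W W' (m : matched s Z Z') (w : matched s W W')
    (f : LHom Z W) : LHom Z' W' :=
  \sum_i \sum_j mb' w i \oh s (ma w i \oh f \oh mb m j) \oh ma' m j.

Section OneMap.
Variables (Z : lmodType R) (Z' : lmodType S) (W : lmodType R) (W' : lmodType S).
Variables (m : matched s Z Z') (w : matched s W W').

(** Together with the injectivity statement that follows, this characterizes the
transported map by its coordinates and replaces double sums by single ones. *)
Lemma ma'_transport (f : LHom Z W) i :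
  ma' w i \oh transport m w f = \sum_j s (ma w i \oh f \oh mb m j) \oh ma' m j.
Proof.
rewrite /transport exchange_big hcomp_sumr; apply: eq_bigr => j _.
rewrite hcomp_sumr; transitivity
  (\sum_k s (ma w i \oh mb w k \oh (ma w k \oh f \oh mb m j)) \oh ma' m j).
  by apply: eq_bigr => k _; rewrite !hcompA -mabE -end_mapM !hcompA.
rewrite -hcomp_suml -end_map_sum; congr (s _ \oh _).
rewrite -[in RHS](hcompf1 (ma w i)) -(mbaK w) hcomp_sumr !hcomp_suml.
by apply: eq_bigr => k _; rewrite !hcompA.
Qed.

Lemma ma'_inj (f g : LHom Z' W') :
  (forall i, ma' w i \oh f = ma' w i \oh g) -> f = g.
Proof.
move=> fg; rewrite -[f]hcomp1f -[g]hcomp1f -(mbaK' w) !hcomp_suml.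
by apply: eq_bigr => i _; rewrite -!hcompA fg.
Qed.

Lemma transportD : {morph transport m w : f g / f + g}.
Proof.
move=> f g; apply: ma'_inj => i; rewrite hcompDr !ma'_transport -big_split.
apply: eq_bigr => j _; rewrite /= -hcompDl -end_mapD.
by rewrite hcompDr hcompDl.
Qed.

Lemma transport0 : transport m w 0 = 0.
Proof. by apply: (addIr (transport m w 0)); rewrite -transportD !add0r. Qed.

Lemma transport_sum n (f : 'I_n -> LHom Z W) :
  transport m w (\sum_i f i) = \sum_i transport m w (f i).
Proof. exact: (big_morph _ transportD transport0). Qed.

End OneMap.

Lemma transport_comp Z Z' W W' V V' (m : matched s Z Z') (w : matched s W W')
    (v : matched s V V') (g : LHom W V) (f : LHom Z W) :
  transport m v (g \oh f) = transport w v g \oh transport m w f.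
Proof.
apply: (ma'_inj (w := v)) => i; rewrite hcompA !ma'_transport hcomp_suml.
transitivity (\sum_j \sum_l
    s (ma v i \oh g \oh mb w j \oh (ma w j \oh f \oh mb m l)) \oh ma' m l).
  rewrite exchange_big; apply: eq_bigr => l _.
  rewrite -hcomp_suml -end_map_sum; congr (s _ \oh _).
  rewrite -[in LHS](hcompf1 g) -(mbaK w) hcomp_sumr !hcomp_suml hcomp_sumr.
  by rewrite hcomp_suml; apply: eq_bigr => j _; rewrite !hcompA.
apply: eq_bigr => j _; rewrite -[RHS]hcompA ma'_transport hcomp_sumr.
by apply: eq_bigr => l _; rewrite end_mapM hcompA.
Qed.

Lemma transport_id Z Z' (m : matched s Z Z') : transport m m (hid Z) = hid Z'.
Proof.
apply: (ma'_inj (w := m)) => i; rewrite ma'_transport.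
rewrite -(mbaK' m) hcomp_sumr; apply: eq_bigr => j _.
by rewrite hcompf1 mabE hcompA.
Qed.

Lemma transport_summand Z Z' W W' (m : matched s Z Z') (w : matched s W W') :
  summand_of Z W -> summand_of Z' W'.
Proof.
move=> [n [a [b ba]]].
exists n, (fun i => transport m w (a i)), (fun i => transport w m (b i)).
rewrite -(transport_id m) -ba transport_sum.
by apply: eq_bigr => i _; symmetry; apply: transport_comp.
Qed.

Lemma matched_target_summand Z Z' (m : matched s Z Z') : summand_of Z' Y.
Proof. by exists (msize m), (ma' m), (mb' m); apply: mbaK'. Qed.

Definition matched_self : matched s X Y.
Proof.
refine (@Matched _ _ _ _ s X Y 1 (fun=> hid X) (fun=> hid X)
  (fun=> hid Y) (fun=> hid Y) _ _ _) => [||_ _];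
  rewrite ?big_ord1 //= ?hcomp1f //.
exact: end_map1.
Defined.

End TransportMap.

Lemma transportK (R S : pzRingType) (X : lmodType R) (Y : lmodType S)
    (s : end_iso X Y) Z Z' W W' (m : matched s Z Z') (w : matched s W W') :
  cancel (transport m w) (transport (matched_sym m) (matched_sym w)).
Proof.
move=> f; apply: (ma'_inj (w := matched_sym w)) => i; rewrite ma'_transport.
have fE : ma w i \oh f = \sum_j ma w i \oh f \oh mb m j \oh ma m j.
  rewrite -[LHS]hcompf1 -(mbaK m) hcomp_sumr.
  by apply: eq_bigr => j _; rewrite !hcompA.
rewrite [RHS]fE; apply: eq_bigr => j _; congr (_ \oh _).
apply: (can_inj (end_invK (end_iso_sym s))); rewrite end_mapK.
rewrite -[LHS]/(ma' w i \oh transport m w f \oh mb' m j).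
rewrite ma'_transport hcomp_suml -[RHS]/(s (ma w i \oh f \oh mb m j)).
rewrite -[in RHS](hcompf1 (ma w i \oh f)) -(mbaK m) hcomp_sumr hcomp_suml.
rewrite end_map_sum; apply: eq_bigr => l _.
by rewrite -hcompA -mabE -end_mapM !hcompA.
Qed.

Lemma transportVK (R S : pzRingType) (X : lmodType R) (Y : lmodType S)
    (s : end_iso X Y) Z Z' W W' (m : matched s Z Z') (w : matched s W W') :
  cancel (transport (matched_sym m) (matched_sym w)) (transport m w).
Proof. exact: (transportK (matched_sym m) (matched_sym w)). Qed.

Definition transport_end_iso (R S : pzRingType) (X : lmodType R) (Y : lmodType S)
    (s : end_iso X Y) Z Z' (m : matched s Z Z') : end_iso Z Z'.
Proof.
refine (@EndIso _ _ Z Z' (transport m m) (transport (matched_sym m) (matched_sym m))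
  (transportK m m) _ _ _ _).
- exact: transportVK.
- exact: transportD.
- by move=> f g; apply: transport_comp.
- exact: transport_id.
Defined.

(** * Finite free modules and lattices *)

Section FreeModules.
Variable R : pzRingType.
Implicit Types M N P : lmodType R.

Fact lincomb_linear M n (g : 'I_n -> M) :
  linear (fun c : 'rV[R]_n => \sum_i c 0 i *: g i).
Proof.
move=> a c d; rewrite scaler_sumr -big_split; apply: eq_bigr => i _.
by rewrite !mxE scalerDl scalerA.
Qed.

Definition lincomb M n (g : 'I_n -> M) : LHom 'rV[R]_n M := mklin (lincomb_linear g).

Lemma lincombE M n (g : 'I_n -> M) c : lincomb g c = \sum_i c 0 i *: g i.
Proof. by []. Qed.

Lemma row_hom_ext M n (f g : LHom 'rV[R]_n M) :
  (forall i, f (delta_mx 0 i) = g (delta_mx 0 i)) -> f = g.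
Proof.
move=> fg; apply: HomP => c; rewrite (row_sum_delta c) !linear_sum.
by apply: eq_bigr => i _; rewrite !linearZ_LR fg.
Qed.

Lemma fin_genP M : fin_gen M <->
  exists n (f : LHom 'rV[R]_n M), forall y, exists x, f x = y.
Proof.
split=> [[n [g gen]]|[n [f fsurj]]].
  exists n, (lincomb g) => y; have [c ->] := gen y; exists (\row_i c i).
  by rewrite lincombE; apply: eq_bigr => i _; rewrite mxE.
exists n, (fun i => f (delta_mx 0 i)) => y; have [x <-] := fsurj y.
exists (fun i => x 0 i); rewrite {1}(row_sum_delta x) linear_sum.
by apply: eq_bigr => i _; rewrite linearZ_LR.
Qed.

Lemma fin_gen_surj M N (f : LHom M N) :
  (forall y, exists x, f x = y) -> fin_gen M -> fin_gen N.
Proof.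
move=> fsurj /fin_genP[n [g gsurj]]; apply/fin_genP; exists n, (f \oh g) => y.
by have [x <-] := fsurj y; have [z <-] := gsurj x; exists z.
Qed.

Lemma row_fin_gen n : fin_gen ('rV[R]_n).
Proof. by apply/fin_genP; exists n, (hid _) => y; exists y. Qed.

Fact row_coord_linear n (i : 'I_n) : linear (fun c : 'rV[R]_n => c 0 i : reg R).
Proof. by move=> a c d; rewrite !mxE. Qed.

Lemma row_summand n : summand_of ('rV[R]_n) (reg R).
Proof.
exists n, (fun i => mklin (row_coord_linear i)), (fun i => elt_map (delta_mx 0 i)).
apply: HomP => c; rewrite Hom_sumE [RHS](row_sum_delta c).
by apply: eq_bigr => i _.
Qed.

Lemma reg_fin_gen : fin_gen (reg R).
Proof.
apply: (@fin_gen_surj _ _ (mklin (row_coord_linear ord0))) (row_fin_gen 1) => y.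
by exists (const_mx y); rewrite mklinE mxE.
Qed.

Definition torsionless M : Prop :=
  exists n (e : LHom M 'rV[R]_n), injective e.

Lemma torsionless_inj M N (f : LHom M N) :
  injective f -> torsionless N -> torsionless M.
Proof. by move=> finj [n [e einj]]; exists n, (e \oh f); apply: inj_comp. Qed.

Fact row_of_homs_linear M n (a : 'I_n -> LHom M (reg R)) :
  linear (fun x => \row_i (a i x : R)).
Proof. by move=> c x y; apply/rowP => i; rewrite !mxE linearP. Qed.

Lemma summand_reg_torsionless M : summand_of M (reg R) -> torsionless M.
Proof.
move=> [n [a [b ba]]]; exists n, (mklin (row_of_homs_linear a)).
move=> x y /rowP xy; rewrite -[x]/(hid M x) -[y]/(hid M y) -ba !Hom_sumE.
by apply: eq_bigr => i _; have := xy i; rewrite !mxE !hcompE => ->.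
Qed.

Lemma summand_reg_fin_gen M : summand_of M (reg R) -> fin_gen M.
Proof.
move=> [n [a [b ba]]]; exists n, (fun i => b i (1 : R)) => x.
exists (fun i => a i x); rewrite -[LHS]/(hid M x) -ba Hom_sumE.
by apply: eq_bigr => i _; rewrite hcompE reg_homE.
Qed.

(** Summands of finite free modules are projective: choose preimages of the
images of the generators b_i(1). *)
Lemma summand_reg_lift P M N (f : LHom M N) (g : LHom P N) :
  summand_of P (reg R) -> (forall y, exists x, f x = y) ->
  exists h : LHom P M, f \oh h = g.
Proof.
move=> [n [a [b ba]]] fsurj.
pose x i := sval (cid (fsurj (g (b i (1 : R))))).
exists (\sum_i elt_map (x i) \oh a i).
rewrite hcomp_sumr -[RHS]hcompf1 -ba hcomp_sumr; apply: eq_bigr => i _.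
rewrite !hcompA comp_elt_map; congr (_ \oh _); apply: reg_hom_ext.
by rewrite elt_map1 hcompE /x; case: cid.
Qed.

End FreeModules.

Definition lattice (R : pzRingType) (M : lmodType R) : Prop :=
  fin_gen M /\ torsionless M.

Lemma row_lattice (R : pzRingType) n : lattice ('rV[R]_n).
Proof. by split; [apply: row_fin_gen | exists n, (hid _) => x y]. Qed.

Lemma reg_lattice (R : pzRingType) : lattice (reg R).
Proof.
by split; [apply: reg_fin_gen | apply/summand_reg_torsionless/summand_refl].
Qed.

(** * Recovering a ring from its lattices *)

Section Recover.
Variables (R S : pzRingType) (X : lmodType R) (Y : lmodType S).
Hypotheses (genX : forall M : lmodType R, lattice M <-> summand_of M X)
           (genY : forall M : lmodType S, lattice M <-> summand_of M Y).
Variable s : end_iso X Y.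

Lemma matched_to M : lattice M -> exists Z, inhabited (matched s Z M).
Proof.
move=> /genY/(matched_exists (end_iso_sym s))[Z [m]].
by exists Z; constructor; apply: matched_unsym.
Qed.

(** Injectivity of a map of lattices is tested on maps out of the regular module,
which is itself a lattice, so the transported map is again a monomorphism. *)
Lemma matched_inj Z Z' W W' (m : matched s Z Z') (w : matched s W W')
    (f : LHom Z W) : injective f -> injective (transport m w f).
Proof.
move=> finj; apply: linear_inj0 => x fx0.
have [U [u]] := matched_to (reg_lattice S).
have [xi xiE] : exists xi, transport u m xi = elt_map x.
  exists (transport (matched_sym u) (matched_sym m) (elt_map x)).
  by rewrite transportVK.
have f_xi : f \oh xi = 0.
  apply: (can_inj (transportK u w)); rewrite (transport_comp u m w) transport0 xiE.
  by rewrite comp_elt_map fx0; apply: reg_hom_ext; rewrite elt_map1.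
have xi0 : xi = 0.
  by apply: HomP => z; apply: finj; rewrite -hcompE f_xi Hom0E linear0.
by rewrite -[x]elt_map1 -xiE xi0 transport0.
Qed.

(** Transport preserves projectivity of the regular module. A surjection phi' from
a free module onto P corresponds to phi : Z -> R. The image I of phi is a lattice,
and the transport of I -> R is injective, and surjective because phi' factors
through it; hence I = R, phi splits, and so does phi'. *)
Lemma matched_reg_summand P (m : matched s (reg R) P) : summand_of P (reg S).
Proof.
have [/fin_genP[n [phi' phi'_surj]] _] : lattice P.
  exact/genY/matched_target_summand/m.
have [Z [w]] := matched_to (row_lattice S n).
pose phi := transport (matched_sym w) (matched_sym m) phi'.
have phiE : transport w m phi = phi' by apply: transportVK.
have [genZ _] : lattice Z.
  by apply/genX; apply: (matched_target_summand (matched_sym w)).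
have [p [pE psurj]] := image_factor phi.
pose I := image_sub phi; pose i : LHom (smod I) (reg R) := sub_incl I.
have ipE : i \oh p = phi by apply: HomP.
have iinj : injective i by apply: smod_incl_inj.
have [I' [v]] : exists I', inhabited (matched s (smod I) I').
  apply: matched_exists; apply/genX; split; first exact: fin_gen_surj psurj genZ.
  by apply: torsionless_inj iinj _; have [] := reg_lattice R.
have [|g [gi ig]] := hom_bij_inv (matched_inj (m := v) (w := m) iinj).
  move=> y; have [x <-] := phi'_surj y.
  exists (transport w v p x).
  by rewrite -hcompE -(transport_comp w v m) ipE phiE.
pose j := transport (matched_sym m) (matched_sym v) g.
have ij : i \oh j = hid _.
  apply: (can_inj (transportK m m)).
  by rewrite (transport_comp m v m) transport_id transportVK.
have [|h phih] := @summand_reg_lift _ _ _ _ phi (hid (reg R)) (summand_refl _).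
  move=> y; have [x xE] := psurj (j y); exists x.
  by rewrite -ipE hcompE xE -hcompE ij.
apply: summand_trans (row_summand S n).
apply: (@retract_summand _ _ _ (transport m w h) phi').
by rewrite -phiE -(transport_comp m w m) phih transport_id.
Qed.

End Recover.

(** The lattice P that matches R is a summand of a power of S by the previous lemma.
The same lemma in the other direction puts the match of S in add(R), which is
transported back to S in add(P). *)
Lemma recover_ring (R S : pzRingType) (X : lmodType R) (Y : lmodType S)
    (genX : forall M : lmodType R, lattice M <-> summand_of M X)
    (genY : forall M : lmodType S, lattice M <-> summand_of M Y) :
  end_iso X Y -> Morita_equivalent (End_mod (reg R)) (End_mod (reg S)).
Proof.
move=> s.
have [P [m]] : exists P, inhabited (matched s (reg R) P).
  by apply: matched_exists; apply/genX; apply: reg_lattice.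
have [Q [w]] := matched_to genY s (reg_lattice S).
have PS := matched_reg_summand genX genY m.
have QR := matched_reg_summand genY genX (matched_sym w).
have SP : summand_of (reg S) P := transport_summand w m QR.
apply: Morita_trans (End_Morita PS SP).
exact/ring_iso_Morita/end_iso_ring_iso/(transport_end_iso m).
Qed.

Section EquivalenceEnd.
Variables (R S : pzRingType) (F : mod_functor R S) (H : mod_functor S R).
Hypothesis FH : inverse_functors F H.

Definition equiv_end_iso (M : rmodType R) : end_iso M (F M).
Proof.
pose t (f : LHom (F M) (F M)) := sval (cid (equiv_full FH f)).
have tK : cancel t (@hmap _ _ F M M) by move=> f; rewrite /t; case: cid.
refine (@EndIso _ _ M (F M) (@hmap _ _ F M M) t _ tK _ _ _).
- by move=> f; apply: (equiv_faithful FH); rewrite tK.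
- by move=> f g; apply: (equiv_mapD FH).
- by move=> f g; apply: hmap_comp.
- exact: hmap_id.
Defined.

End EquivalenceEnd.

(** The free module End(X) of rank one goes to a summand Q of a power of End(Y) with
the same endomorphism ring. Since End(Y) is the endomorphism ring both of itself
as a module and of Y, the idempotent that defines Q also splits over Y. *)
Lemma Morita_end_iso (R S : pzRingType) (X : lmodType R) (Y : lmodType S) :
  Morita_equivalent (End_mod X) (End_mod Y) ->
  exists Z : lmodType S,
    [/\ summand_of Z Y, summand_of Y Z & inhabited (end_iso X Z)].
Proof.
move=> [F [H FH]].
have QA := equiv_reg_summand FH; have AQ := equiv_generator FH.
pose s := reg_end_iso Y.
have [Z [m]] := matched_exists s QA.
exists Z; split.
- exact: matched_target_summand m.
- exact: (transport_summand (matched_self s) m AQ).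
- constructor; apply: end_iso_trans (end_iso_sym (reg_end_iso X)) _.
  apply: end_iso_trans (equiv_end_iso FH _) _.
  exact: transport_end_iso m.
Qed.

Section EquivalenceLattice.
Variables (R S : pzRingType) (F : mod_functor R S) (H : mod_functor S R).
Hypothesis FH : inverse_functors F H.

(** An element of F(N) is a combination of values of maps F(R) -> F(N), as F(R) is a
generator; these come from maps R -> N, which lift through f. *)
Lemma equiv_surj (M N : rmodType R) (f : LHom M N) :
  (forall y, exists x, f x = y) -> forall y, exists x, hmap F f x = y.
Proof.
move=> fsurj y; have [n [a [b ba]]] := equiv_generator FH.
have lift i : exists h, hmap F f \oh h = elt_map y \oh b i.
  have [g gE] := equiv_full FH (elt_map y \oh b i).
  have [h fh] := summand_reg_lift g (summand_refl _) fsurj.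
  by exists (hmap F h); rewrite -hmap_comp fh.
have [h hE] := choice lift.
exists (\sum_i h i (a i (1 : S))).
rewrite linear_sum -[RHS]elt_map1 -[elt_map y]hcompf1 -ba hcomp_sumr Hom_sumE.
by apply: eq_bigr => i _; rewrite hcompA -hE.
Qed.

Lemma equiv_lattice (M : rmodType R) : lattice M -> lattice (F M).
Proof.
have FP (P : rmodType R) : summand_of P (reg R^c) -> summand_of (F P) (reg S^c).
  move=> /(equiv_summand FH) FPR.
  exact: summand_trans FPR (equiv_reg_summand FH).
move=> [/fin_genP[m [f fsurj]] [n [e einj]]]; split.
  apply: fin_gen_surj (equiv_surj fsurj) _.
  exact/summand_reg_fin_gen/FP/row_summand.
apply: torsionless_inj (equiv_inj FH einj) _.
exact/summand_reg_torsionless/FP/row_summand.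
Qed.

End EquivalenceLattice.

Lemma Morita_End_generators (R S : pzRingType) (X : rmodType R) (Y : rmodType S)
    (genX : forall M : rmodType R, lattice M <-> summand_of M X)
    (genY : forall M : rmodType S, lattice M <-> summand_of M Y) :
  Morita_equivalent R S -> Morita_equivalent (End_mod X) (End_mod Y).
Proof.
move=> [F [H FH]]; have HF := inverse_functors_sym FH.
apply: (@Morita_trans _ (End_mod (F X))).
  exact/ring_iso_Morita/end_iso_ring_iso/(equiv_end_iso FH).
apply: End_Morita.
  exact/genY/(equiv_lattice FH)/genX/summand_refl.
have /genX/(equiv_summand FH) : lattice (H Y).
  exact/(equiv_lattice HF)/genY/summand_refl.
have [u [v [vu uv _]]] := equiv_unit HF.
by apply: summand_trans; apply: retract_summand (uv Y).
Qed.

Lemma Morita_of_End_generators (R S : pzRingType) (X : rmodType R) (Y : rmodType S)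
    (genX : forall M : rmodType R, lattice M <-> summand_of M X)
    (genY : forall M : rmodType S, lattice M <-> summand_of M Y) :
  Morita_equivalent (End_mod X) (End_mod Y) -> Morita_equivalent R S.
Proof.
move=> /Morita_end_iso[Z [ZY YZ [s]]].
have genZ (M : rmodType S) : lattice M <-> summand_of M Z.
  by rewrite genY; split=> MS; apply: summand_trans MS _.
have RS := recover_ring genX genZ s.
apply: Morita_trans (ring_iso_Morita (reg_end_ring_iso R)) _.
apply: Morita_trans RS _.
exact/Morita_sym/ring_iso_Morita/reg_end_ring_iso.
Qed.

(** * Noetherian modules *)

Section FinitelyGeneratedSubmodules.
Variable R : pzRingType.
Implicit Types M N : lmodType R.

Lemma smemB M (S : submodule M) x y : smem S x -> smem S y -> smem S (x - y).
Proof. by move=> Sx Sy; apply: smemD => //; rewrite -scaleN1r; apply: smemZ. Qed.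

Lemma smem_sum M (S : submodule M) I (r : seq I) (P : pred I) (F : I -> M) :
  (forall i, P i -> smem S (F i)) -> smem S (\sum_(i <- r | P i) F i).
Proof.
by move=> SF; elim/big_rec: _ => [|i x /SF]; [apply: smem0 | apply: smemD].
Qed.

Definition span_sub M (l : seq M) : submodule M.
Proof.
exists (fun x => exists c : nat -> R, x = \sum_(i < size l) c i *: l`_i).
- by exists (fun=> 0); rewrite big1 // => i _; rewrite scale0r.
- move=> _ _ [c ->] [d ->]; exists (fun i => c i + d i).
  by rewrite -big_split; apply: eq_bigr => i _; rewrite scalerDl.
- move=> a _ [c ->]; exists (fun i => a * c i).
  by rewrite scaler_sumr; apply: eq_bigr => i _; rewrite scalerA.
Defined.

Lemma span_mem M (l : seq M) x : x \in l -> smem (span_sub l) x.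
Proof.
move=> xl; have xi : (index x l < size l)%N by rewrite index_mem.
exists (fun i => (i == index x l)%:R).
rewrite (bigD1 (Ordinal xi)) //= eqxx scale1r nth_index // big1 ?addr0 // => i.
by rewrite -val_eqE /= => /negPf->; rewrite scale0r.
Qed.

Lemma span_min M (l : seq M) (S : submodule M) x :
  (forall y, y \in l -> smem S y) -> smem (span_sub l) x -> smem S x.
Proof.
by move=> lS [c ->]; apply: smem_sum => i _; apply/smemZ/lS/mem_nth.
Qed.

Definition fin_gen_sub M (S : submodule M) : Prop :=
  exists l : seq M, (forall x, x \in l -> smem S x) /\
    forall x, smem S x -> smem (span_sub l) x.

Definition noetherian_mod M : Prop := forall S : submodule M, fin_gen_sub S.

Definition img_sub M N (f : {linear M -> N}) (S : submodule M) : submodule N.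
Proof.
exists (fun y => exists2 x, smem S x & f x = y).
- by exists 0; [apply: smem0 | rewrite linear0].
- by move=> _ _ [x Sx <-] [y Sy <-]; exists (x + y); [apply: smemD | rewrite linearD].
- by move=> a _ [x Sx <-]; exists (a *: x); [apply: smemZ | rewrite linearZ_LR].
Defined.

Definition ker_in_sub M N (f : {linear M -> N}) (S : submodule M) : submodule M.
Proof.
exists (fun x => smem S x /\ f x = 0).
- by split; [apply: smem0 | rewrite linear0].
- by move=> x y [Sx fx] [Sy fy]; split; [apply: smemD | rewrite linearD fx fy addr0].
- by move=> a x [Sx fx]; split; [apply: smemZ | rewrite linearZ_LR fx scaler0].
Defined.

Lemma lift_seq M N (f : {linear M -> N}) (S : submodule M) (l : seq N) :
  (forall y, y \in l -> smem (img_sub f S) y) ->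
  exists2 l' : seq M, forall x, x \in l' -> smem S x & map f l' = l.
Proof.
elim: l => [|y l IHl] lS; first by exists [::].
have [|l' l'S <-] := IHl; first by move=> z zl; apply: lS; rewrite inE zl orbT.
have [x Sx <-] := lS y (mem_head _ _); exists (x :: l') => // z.
by rewrite inE => /predU1P[->|/l'S].
Qed.

Lemma fin_gen_sub_ext M N (f : {linear M -> N}) (S : submodule M) :
  fin_gen_sub (img_sub f S) -> fin_gen_sub (ker_in_sub f S) -> fin_gen_sub S.
Proof.
move=> [l [/lift_seq[l1 l1S <-] lgen]] [l2 [l2S l2gen]].
exists (l1 ++ l2); split=> [x|x Sx].
  by rewrite mem_cat => /orP[/l1S|/l2S[]].
have [u ul1 fu] : smem (img_sub f (span_sub l1)) (f x).
  apply: (span_min (l := map f l1)); last by apply: lgen; exists x.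
  by move=> _ /mapP[u ul ->]; exists u => //; apply: span_mem.
have Su : smem S u by apply: span_min ul1.
have xu : smem (ker_in_sub f S) (x - u).
  by split; [apply: smemB | rewrite linearB fu subrr].
rewrite -(subrK u x) addrC; apply: smemD.
  by apply: span_min ul1 => y yl; apply: span_mem; rewrite mem_cat yl.
apply: span_min (l2gen _ xu) => y yl.
by apply: span_mem; rewrite mem_cat yl orbT.
Qed.

Definition preim_sub M N (f : {linear M -> N}) (S : submodule N) : submodule M.
Proof.
exists (fun x => smem S (f x)).
- by rewrite linear0; apply: smem0.
- by move=> x y Sx Sy; rewrite linearD; apply: smemD.
- by move=> a x Sx; rewrite linearZ_LR; apply: smemZ.
Defined.

Lemma noetherian_image M N (f : {linear M -> N}) (S : submodule N) :
  noetherian_mod M -> (forall y, smem S y -> exists x, f x = y) -> fin_gen_sub S.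
Proof.
move=> noethM fS; have [l [lS lgen]] := noethM (preim_sub f S).
exists (map f l); split=> [_ /mapP[x xl ->]|y Sy]; first exact: lS.
have [x xy] := fS y Sy; rewrite -xy in Sy *.
apply: (span_min (S := preim_sub f (span_sub (map f l)))) (lgen x Sy) => z zl.
exact/span_mem/map_f.
Qed.

Lemma noetherian_row n : noetherian_mod (reg R) -> noetherian_mod 'rV[R]_n.
Proof.
move=> noethR; elim: n => [|n IHn] S.
  exists [::]; split=> // x _; rewrite [x]thinmx0; exact: smem0.
have lf : linear (fun c : 'rV[R]_(1 + n) => c 0 0 : reg R).
  by move=> a c d; rewrite !mxE.
apply: (fin_gen_sub_ext (f := mklin lf)); first exact: noethR.
have lg : linear (fun c : 'rV[R]_n => row_mx 0 c : 'rV[R]_(1 + n)).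
  by move=> a c d; rewrite scale_row_mx add_row_mx scaler0 addr0.
apply: (noetherian_image (f := mklin lg)) IHn _ => y [_ y0].
exists (rsubmx (y : 'rV[R]_(1 + n))); rewrite mklinE -[RHS]hsubmxK.
congr row_mx; apply/rowP => i; rewrite !mxE ord1 -[LHS]y0 mklinE.
by congr (y _ _); apply: val_inj.
Qed.

End FinitelyGeneratedSubmodules.

(** * Artinian commutative rings are noetherian *)

Section TailSpan.
Variables (R : pzRingType) (M : lmodType R) (x : nat -> M).

Lemma tail_sum_widen n m m' (c : nat -> R) : (m <= m')%N ->
  \sum_(n <= i < m) c i *: x i =
  \sum_(n <= i < m') (if (i < m)%N then c i else 0) *: x i.
Proof.
move=> mm'; rewrite (big_nat_widen _ _ _ _ _ mm') big_mkcond.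
by apply: eq_bigr => i _; rewrite andTb; case: ifP => _; rewrite ?scale0r.
Qed.

(** The span of x_n, x_(n+1), ..., with a bound m on the length of the combination;
combinations of different lengths are padded with zeros to be added. *)
Definition tail_sub (n : nat) : submodule M.
Proof.
exists (fun y => exists m c, y = \sum_(n <= i < m) c i *: x i).
- by exists 0%N, (fun=> 0); rewrite big_geq.
- move=> _ _ [m [c ->]] [m' [c' ->]]; exists (maxn m m').
  rewrite (tail_sum_widen _ c (leq_maxl m m')).
  rewrite (tail_sum_widen _ c' (leq_maxr m m')) -big_split.
  exists (fun i => (if (i < m)%N then c i else 0) + (if (i < m')%N then c' i else 0)).
  by apply: eq_bigr => i _; rewrite scalerDl.
- move=> a _ [m [c ->]]; exists m, (fun i => a * c i).
  by rewrite scaler_sumr; apply: eq_bigr => i _; rewrite scalerA.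
Defined.

Lemma tail_sub_mem n i : (n <= i)%N -> smem (tail_sub n) (x i).
Proof.
move=> ni; exists i.+1, (fun j => (j == i)%:R).
rewrite big_nat_recr //= eqxx scale1r big_nat big1 ?add0r // => j /andP[_ ji].
by rewrite ltn_eqF // scale0r.
Qed.

Lemma tail_sub_decr n y : smem (tail_sub n.+1) y -> smem (tail_sub n) y.
Proof.
move=> [m [c ->]]; rewrite big_nat; apply: smem_sum => i /andP[ni _].
exact/smemZ/tail_sub_mem/ltnW.
Qed.

End TailSpan.

Section Artinian.
Variable k : comPzRingType.
Hypothesis artk : artinian k.
Local Notation ideal := (submodule (reg k)).

Lemma artinian_stable (I : nat -> ideal) :
  (forall n x, smem (I n.+1) x -> smem (I n) x) ->
  exists N, forall n, (N <= n)%N -> forall x, smem (I n) x <-> smem (I N) x.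
Proof.
move=> decI; have [||N stab] := artk (I := fun n => spred (I n)).
- by move=> n; apply: spred_submod_closed.
- by move=> n x /spredP Ix; apply/spredP/decI.
exists N => n Nn x; have E := stab n Nn x.
by split=> /spredP Ix; apply/spredP; [rewrite -E | rewrite E].
Qed.

Lemma minimal_ideal (P : ideal -> Prop) : (exists I, P I) ->
  exists2 I, P I & forall J, (forall x, smem J x -> smem I x) -> P J ->
    forall x, smem I x -> smem J x.
Proof.
move=> [I0 PI0]; apply: contrapT => nmin.
have step (I : {I | P I}) : exists J : {J | P J},
    (forall x, smem (sval J) x -> smem (sval I) x) /\
    exists2 x, smem (sval I) x & ~ smem (sval J) x.
  case: I => I PI; apply: contrapT => nstep; apply: nmin.
  exists I => // J JI PJ x Ix; apply: contrapT => nJx; apply: nstep.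
  by exists (exist _ J PJ); split=> //; exists x.
have [f fP] := choice step.
pose I n := sval (iter n f (exist _ I0 PI0)).
have [N stab] := @artinian_stable I (fun n => proj1 (fP _)).
have [_ [x Ix nx]] := fP (iter N f (exist _ I0 PI0)).
by apply: nx; apply/(stab N.+1).
Qed.

(** Let I be minimal among the ideals that are not finitely generated. For each a,
either aI = 0 or aI = I: otherwise aI and the kernel of a on I are smaller,
hence finitely generated, and so is I. In the second case a acts invertibly on I,
because the chain of the ideals (a^n) is stationary. So I behaves like a vector
space over a field; choosing each x_n in I outside the span of the previous
ones, the spans of the tails of this sequence would be a strictly decreasing
chain of ideals. *)
Lemma artinian_noetherian : noetherian_mod (reg k).
Proof.
move=> I0; apply: contrapT => nfg0.
have [I nfgI minI] := minimal_ideal (ex_intro (fun I => ~ fin_gen_sub I) I0 nfg0).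
have fgJ (J : ideal) : (forall x, smem J x -> smem I x) ->
    (exists2 x, smem I x & ~ smem J x) -> fin_gen_sub J.
  move=> JI [x Ix nJx]; apply: contrapT => nfgJ; apply: nJx.
  exact: minI nfgJ x Ix.
have mulI (a x : k) : smem I (x : reg k) -> smem I (a * x : reg k).
  by move=> Ix; apply: (smemZ a Ix).
have lmul (a : k) : linear (fun x : reg k => a * (x : k) : reg k).
  by move=> c x y; rewrite mulrDr; congr (_ + _); apply: mulrCA.
have zero_or_div (a : k) : (forall x : k, smem I (x : reg k) -> a * x = 0) \/
    forall x : k, smem I (x : reg k) ->
      exists2 y : k, smem I (y : reg k) & a * y = x.
  apply: contrapT => /not_orP[nz nd]; apply: nfgI.
  apply: (fin_gen_sub_ext (f := mklin (lmul a))); apply: fgJ.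
  - by move=> _ [x Ix <-]; apply: mulI.
  - apply: contrapT => all; apply: nd => x Ix; apply: contrapT => nx.
    by apply: all; exists x => // -[y Iy yx]; apply: nx; exists y.
  - by move=> x [].
  - apply: contrapT => all; apply: nz => x Ix; apply: contrapT => nx.
    by apply: all; exists x => // -[_].
have inverse (a : k) : (forall x : k, smem I (x : reg k) -> a * x = 0) \/
    exists b : k, forall x : k, smem I (x : reg k) -> b * (a * x) = x.
  case: (zero_or_div a) => [|div]; [by left | right].
  have divn n (x : k) : smem I (x : reg k) ->
      exists2 y : k, smem I (y : reg k) & a ^+ n * y = x.
    elim: n x => [|n IHn] x Ix; first by exists x; rewrite ?mul1r.
    have [y Iy <-] := IHn x Ix; have [z Iz <-] := div y Iy.
    by exists z => //; rewrite exprSr mulrA.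
  have [|N stab] := @artinian_stable (fun n => span_sub [:: a ^+ n : reg k]).
    move=> n x; apply: span_min => _ /[!inE] /eqP->.
    rewrite exprS -[_ * _]/(a *: (a ^+ n : reg k)); apply/smemZ/span_mem.
    exact: mem_head.
  have [c] := (stab N.+1 (leqnSn N) (a ^+ N)).2 (span_mem (mem_head _ _)).
  rewrite big_ord1 -[_ *: _]/(c 0%N * a ^+ N.+1) => aN.
  exists (c 0%N) => x Ix; have [y Iy <-] := divn N x Ix.
  by rewrite (mulrA a) -exprS mulrA -aN.
have pick_ex (l : seq (reg k)) : exists x : reg k,
    (forall y, y \in l -> smem I y) -> smem I x /\ ~ smem (span_sub l) x.
  apply: contrapT => /forallNP nx; apply: nfgI; exists l.
  have lI : forall y, y \in l -> smem I y.
    by apply: contrapT => nlI; apply: (nx 0).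
  by split=> // x Ix; apply: contrapT => nlx; apply: (nx x).
have [pick pickP] := choice pick_ex.
pose l n : seq (reg k) := iter n (fun l => rcons l (pick l)) [::].
pose x n := pick (l n).
have lI n y : y \in l n -> smem I y.
  elim: n y => [|n IHn] y //=; rewrite mem_rcons inE => /predU1P[->|/IHn//].
  by case: (pickP _ IHn).
have xI n : smem I (x n) by case: (pickP _ (lI n)).
have nx n : ~ smem (span_sub (l n)) (x n) by case: (pickP _ (lI n)).
have xl i n : (i < n)%N -> x i \in l n.
  elim: n => // n IHn; rewrite ltnS leq_eqVlt /= mem_rcons inE.
  by move=> /predU1P[->|/IHn->]; rewrite ?eqxx ?orbT.
(* x_N lies in the span of the later terms. Remove the last term of such a
   combination as long as its coefficient kills I; otherwise that coefficient
   is invertible on I and its vector lies in the span of the previous ones. *)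
have [N stab] := artinian_stable (tail_sub_decr (x := x)).
have [m [c xN]] := (stab N.+1 (leqnSn N) (x N)).2 (tail_sub_mem x (leqnn N)).
elim: m xN => [|m IHm] xN.
  by apply: (nx N); rewrite xN big_geq //; apply: smem0.
case: (leqP N.+1 m) xN => [Nm|mN]; last first.
  by rewrite big_geq // => xN; apply: (nx N); rewrite xN; apply: smem0.
rewrite big_nat_recr //=; case: (inverse (c m)) => [cm0|[b bK]] xN.
  by apply: IHm; rewrite [LHS]xN -[c m *: _]/(c m * x m) cm0 ?addr0.
apply: (nx m); rewrite -[x m]bK //.
have -> : c m * x m = x N - \sum_(N.+1 <= i < m) c i *: x i.
  apply/eqP; rewrite eq_sym subr_eq; apply/eqP.
  by rewrite [LHS]xN [LHS]addrC.
apply: (smemZ b); apply: smemB; first exact/span_mem/xl.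
rewrite big_nat; apply: smem_sum => i /andP[_ im].
exact/smemZ/span_mem/xl.
Qed.

End Artinian.

(** * Exact sequences of matrices *)

Section MatrixExactness.
Variable R : pzRingType.

(** Exactness of the complex of free left modules given by A and B acting on rows;
stated for matrices V with any number of rows, it also yields factorizations of
maps between free modules. *)
Definition rexact m n q (A : 'M[R]_(m, n)) (B : 'M[R]_(n, q)) : Prop :=
  forall p (V : 'M[R]_(p, n)), V *m B = 0 <-> exists U, V = U *m A.

Definition cexact m n q (A : 'M[R]_(m, n)) (B : 'M[R]_(n, q)) : Prop :=
  forall p (W : 'M[R]_(n, p)), A *m W = 0 <-> exists U, W = B *m U.

Lemma rexact_mul0 m n q (A : 'M[R]_(m, n)) (B : 'M[R]_(n, q)) :
  rexact A B -> A *m B = 0.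
Proof. by move=> /(_ _ A)[_]; apply; exists 1%:M; rewrite mul1mx. Qed.

Lemma cexact_mul0 m n q (A : 'M[R]_(m, n)) (B : 'M[R]_(n, q)) :
  cexact A B -> A *m B = 0.
Proof. by move=> /(_ _ B)[_]; apply; exists 1%:M; rewrite mulmx1. Qed.

Lemma rexact_rows m n q (A : 'M[R]_(m, n)) (B : 'M[R]_(n, q)) :
  A *m B = 0 -> (forall v : 'rV_n, v *m B = 0 -> exists u, v = u *m A) ->
  rexact A B.
Proof.
move=> AB ker p V; split=> [VB|[U ->]]; last by rewrite -mulmxA AB mulmx0.
have /choice[u uE] (i : 'I_p) : exists u : 'rV_m, row i V = u *m A.
  by apply: ker; rewrite -row_mul VB row0.
exists (\matrix_i u i); apply/row_matrixP => i.
by rewrite row_mul rowK.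
Qed.

Lemma cexact_cols m n q (A : 'M[R]_(m, n)) (B : 'M[R]_(n, q)) :
  A *m B = 0 -> (forall w : 'cV_n, A *m w = 0 -> exists u, w = B *m u) ->
  cexact A B.
Proof.
move=> AB ker p W; split=> [AW|[U ->]]; last by rewrite mulmxA AB mul0mx.
have /choice[u uE] (j : 'I_p) : exists u : 'cV_q, col j W = B *m u.
  by apply: ker; rewrite colE mulmxA AW mul0mx.
exists (\matrix_(i, j) u j i 0); apply/matrixP => i j.
have /matrixP/(_ i 0) := uE j; rewrite !mxE => ->.
by apply: eq_bigr => l _; rewrite !mxE.
Qed.

Lemma rexact_cast m n q q' (e : q = q') (A : 'M[R]_(m, n)) (B : 'M[R]_(n, q)) :
  rexact A B -> rexact A (castmx (erefl n, e) B).
Proof. by case: _ / e; rewrite castmx_id. Qed.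

Lemma cexact_cast m n q q' (e : q = q') (A : 'M[R]_(m, n)) (B : 'M[R]_(n, q)) :
  cexact A B -> cexact A (castmx (erefl n, e) B).
Proof. by case: _ / e; rewrite castmx_id. Qed.

Fact mulR_linear m n (A : 'M[R]_(m, n)) : linear (fun v : 'rV[R]_m => v *m A).
Proof. by move=> a u v; rewrite mulmxDl scalemxAl. Qed.

Definition mulR m n (A : 'M[R]_(m, n)) : LHom 'rV[R]_m 'rV[R]_n :=
  mklin (mulR_linear A).

Lemma mulRE m n (A : 'M[R]_(m, n)) v : mulR A v = v *m A. Proof. by []. Qed.

Lemma hom_mulR m n (f : LHom 'rV[R]_m 'rV[R]_n) : exists A, f = mulR A.
Proof.
exists (\matrix_i f (delta_mx 0 i)); apply: row_hom_ext => i.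
by rewrite mulRE -rowE rowK.
Qed.

(** Ext^2(coker C, R) = 0, computed on the free resolution given by A, B, C. A
column w with A w = 0 is a map f on the middle term that vanishes on ker B. It
extends along B to a map g0 into I0; the map d g0 vanishes on ker C, so it extends
along C and lifts to h with values in I0, and g0 - h C takes its values in R. *)
Lemma cexact_of_inj_dim (id1 : inj_dim_le (reg R) 1) a b c d
    (A : 'M[R]_(a, b)) (B : 'M[R]_(b, c)) (C : 'M[R]_(c, d)) :
  rexact A B -> rexact B C -> cexact A B.
Proof.
move=> AB BC; have [I [dI [e [injI I0 einj ker0 kerS]]]] := id1.
apply: cexact_cols (rexact_mul0 AB) _ => w Aw.
have lf : linear (fun v : 'rV[R]_b => (v *m w) 0 0 : reg R).
  by move=> x u v; rewrite mulmxDl -scalemxAl !mxE.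
pose f : LHom 'rV[R]_b (reg R) := mklin lf.
have [|g0 g0E] := injective_ext (u := mulR B)
    (f := (e : LHom _ _) \oh f : {linear _ -> _}) (injI 0%N).
  move=> v /(AB _ v).1[u ->]; rewrite /= -mulmxA Aw mulmx0 mxE.
  exact: linear0.
have [|g1 g1E] := injective_ext (u := mulR C)
    (f := (dI 0%N : LHom _ _) \oh (g0 : LHom _ _) : {linear _ -> _}) (injI 1%N).
  move=> v /(BC _ v).1[u ->]; rewrite /= -[u *m B]/(mulR B u) g0E.
  by apply/ker0; exists (f u).
have d0_surj (y : I 1%N) : exists x, dI 0%N x = y by apply/kerS/I0.
have [h hE] := summand_reg_lift (f := dI 0%N : LHom _ _) (g1 : LHom _ _)
  (row_summand R d) d0_surj.
pose g' : LHom 'rV[R]_c (I 0%N) := (g0 : LHom _ _) - h \oh mulR C.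
have g'ker v : dI 0%N (g' v) = 0.
  rewrite -[g' v]/(g0 v - h (mulR C v)) linearB -[dI 0%N (h _)]/((_ \oh h) _).
  by rewrite hE g1E subrr.
have lincl : forall v, exists x : reg R, e x = g' v by move=> v; apply/ker0.
have /choice[g gE] := lincl.
have lg : linear g.
  by move=> x u v; apply: einj; rewrite linearP !gE linearP.
exists (\col_i g (delta_mx 0 i)).
have gfE v : g (v *m B) = f v.
  apply: einj; rewrite gE -[g' _]/(g0 (mulR B v) - h (mulR C (mulR B v))).
  by rewrite g0E !mulRE -mulmxA (rexact_mul0 BC) mulmx0 linear0 subr0.
apply/colP => i; have := gfE (delta_mx 0 i).
rewrite -rowE mklinE -rowE [in RHS]mxE => <-.
rewrite -[g _]/(mklin lg (row i B)) {1}(row_sum_delta (row i B)) linear_sum mxE.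
by apply: eq_bigr => j _; rewrite linearZ_LR !mxE mklinE.
Qed.

End MatrixExactness.

(** Columns over the converse ring are transposed rows, so each statement for one
action yields its mirror image for the other. *)
Section Transposition.
Variable R : pzRingType.
Local Notation "A ^tr" := (A^T : 'M[R]_(_, _)) (at level 8, format "A ^tr").
Local Notation "A ^trc" := (A^T : 'M[R^c]_(_, _)) (at level 8, format "A ^trc").

Lemma trmx_mulc m n q (A : 'M[R]_(m, n)) (B : 'M[R]_(n, q)) :
  (A *m B)^T = B^trc *m A^trc.
Proof. exact: trmx_mul_rev. Qed.

Lemma trmxc_mul m n q (A : 'M[R^c]_(m, n)) (B : 'M[R^c]_(n, q)) :
  (A *m B)^T = B^tr *m A^tr.
Proof. by apply: trmx_inj; rewrite trmx_mulc !trmxK. Qed.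

Lemma cexact_tr m n q (A : 'M[R^c]_(m, n)) (B : 'M[R^c]_(n, q)) :
  rexact B^tr A^tr -> cexact A B.
Proof.
move=> ex p W; have := ex p W^tr; rewrite -trmxc_mul => exW.
split=> [AW|[U WE]].
  have [|U UE] := exW.1; first by rewrite AW trmx0.
  by exists U^trc; apply: trmx_inj; rewrite UE trmxc_mul trmxK.
apply: trmx_inj; rewrite trmx0; apply/exW; exists U^tr.
by rewrite WE trmxc_mul.
Qed.

Lemma rexact_tr m n q (A : 'M[R^c]_(m, n)) (B : 'M[R^c]_(n, q)) :
  cexact A B -> rexact B^tr A^tr.
Proof.
move=> ex p V; have := ex p V^trc.
have <- : (V *m A^tr)^trc = A *m V^trc by rewrite trmx_mulc trmxK.
move=> exV; split=> [VA|[U VE]].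
  have [|U UE] := exV.1; first by rewrite VA trmx0.
  by exists U^tr; apply: trmx_inj; rewrite UE trmx_mulc !trmxK.
apply: trmx_inj; rewrite trmx0; apply/exV; exists U^trc.
by rewrite VE trmx_mulc trmxK.
Qed.

Lemma rexact_of_cexact_tr m n q (A : 'M[R^c]_(m, n)) (B : 'M[R^c]_(n, q)) :
  cexact B^tr A^tr -> rexact A B.
Proof.
move=> ex p V; have := ex p V^tr; rewrite -trmxc_mul => exV.
split=> [VB|[U VE]].
  have [|U UE] := exV.1; first by rewrite VB trmx0.
  by exists U^trc; apply: trmx_inj; rewrite UE trmxc_mul trmxK.
apply: trmx_inj; rewrite trmx0; apply/exV; exists U^tr.
by rewrite VE trmxc_mul.
Qed.

Lemma rexact_of_inj_dim (id1 : inj_dim_le (reg R) 1) a b c d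
    (A : 'M[R^c]_(a, b)) (B : 'M[R^c]_(b, c)) (C : 'M[R^c]_(c, d)) :
  cexact A B -> cexact B C -> rexact B C.
Proof.
move=> /rexact_tr AB /rexact_tr BC; apply: rexact_of_cexact_tr.
exact: cexact_of_inj_dim AB.
Qed.

Definition row_kernels_fg (T : pzRingType) : Prop :=
  forall m n (B : 'M[T]_(m, n)), exists l, exists A : 'M[T]_(l, m), rexact A B.

Lemma col_kernels_fg : row_kernels_fg R ->
  forall m n (A : 'M[R^c]_(m, n)), exists l, exists B : 'M[R^c]_(n, l), cexact A B.
Proof.
move=> kerfg m n A; have [l [B BA]] := kerfg _ _ A^tr.
by exists l, B^trc; apply: cexact_tr; rewrite trmxK.
Qed.

End Transposition.

Section KernelsFinGen.
Variables (k : comPzRingType) (R : pzRingType) (i : {rmorphism k -> R}).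
Variables (r : nat) (g : 'I_r -> R).
Hypothesis gen : forall x : R, exists c : 'I_r -> k, x = \sum_j i (c j) * g j.
Hypothesis noethk : noetherian_mod (reg k).

(** R^m is the image of k^(mr) under a map that is linear over k, and a preimage of
an R-submodule is a k-submodule, which is finitely generated. *)
Lemma noetherian_row_of_scalars m : noetherian_mod 'rV[R]_m.
Proof.
move=> S.
pose pi (u : 'rV[k]_(m * r)) : 'rV[R]_m :=
  \row_j \sum_l i (u 0 (mxvec_index j l)) * g l.
have piD u v : pi (u + v) = pi u + pi v.
  apply/rowP => j; rewrite !mxE -big_split; apply: eq_bigr => l _.
  by rewrite mxE rmorphD mulrDl.
have piZ c u : pi (c *: u) = i c *: pi u.
  apply/rowP => j; rewrite !mxE mulr_sumr; apply: eq_bigr => l _.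
  by rewrite mxE rmorphM mulrA.
have pi0 : pi 0 = 0 by rewrite -(scale0r 0) piZ rmorph0 scale0r.
have pi_surj x : exists u, pi u = x.
  have /choice[c cE] (j : 'I_m) := gen (x 0 j).
  exists (mxvec (\matrix_(j, l) c j l)); apply/rowP => j; rewrite mxE [RHS]cE.
  by apply: eq_bigr => l _; rewrite mxvecE mxE.
have preimP (T : submodule 'rV[R]_m) :
    exists T' : submodule 'rV[k]_(m * r), forall u, smem T' u <-> smem T (pi u).
  have T0 : smem T (pi 0) by rewrite pi0; apply: smem0.
  have TD u v : smem T (pi u) -> smem T (pi v) -> smem T (pi (u + v)).
    by rewrite piD; apply: smemD.
  have TZ a u : smem T (pi u) -> smem T (pi (a *: u)).
    by rewrite piZ; apply: smemZ.
  by exists (@Submodule _ _ (fun u => smem T (pi u)) T0 TD TZ).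
have [S' S'E] := preimP S; have [l [lS lgen]] := noetherian_row noethk S'.
exists (map pi l); split=> [_ /mapP[u ul ->]|x Sx]; first exact/S'E/lS.
have [u ux] := pi_surj x; rewrite -ux in Sx *.
have [T TE] := preimP (span_sub (map pi l)); apply/TE.
apply: span_min (lgen u _); last exact/S'E.
by move=> v vl; apply/TE/span_mem/map_f.
Qed.

Lemma row_kernels_fg_of_scalars : row_kernels_fg R.
Proof.
move=> m n B; have [l [lS lgen]] := noetherian_row_of_scalars (ker_sub (mulR B)).
exists (size l), (\matrix_i l`_i); apply: rexact_rows.
  apply/row_matrixP => j; rewrite row_mul rowK row0.
  exact/lS/mem_nth.
move=> v vB; have [c ->] := lgen v vB; exists (\row_j c j).
rewrite mulmx_sum_row; apply: eq_bigr => j _.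
by rewrite rowK mxE.
Qed.

End KernelsFinGen.

(** * Maps to projective modules *)

(** The free module on the underlying set of Q, and its evaluation map to Q. *)
Section FreeCover.
Variables (R : nzRingType) (Q : lmodType R).
Local Open Scope fset_scope.

Definition free_eval (u : {malg R[Q]}) : Q := \sum_(q <- msupp u) u@_q *: q.

Lemma free_evalE (d : {fset Q}) (u : {malg R[Q]}) :
  msupp u `<=` d -> free_eval u = \sum_(q <- d) u@_q *: q.
Proof.
move=> ud; apply: big_fset_incl => // q _ /mcoeff_outdom->.
exact: scale0r.
Qed.

Fact free_eval_linear : linear free_eval.
Proof.
move=> a u v; pose d := msupp (a *: u + v) `|` (msupp u `|` msupp v).
have uvd : msupp (a *: u + v) `<=` d by apply: fsubsetUl.
have ud : msupp u `<=` d by apply: fsubset_trans (fsubsetUl _ _) (fsubsetUr _ _).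
have vd : msupp v `<=` d by apply: fsubset_trans (fsubsetUr _ _) (fsubsetUr _ _).
rewrite (free_evalE uvd) (free_evalE ud) (free_evalE vd) scaler_sumr -big_split.
by apply: eq_bigr => q _; rewrite mcoeffD mcoeffZ scalerDl scalerA.
Qed.

Lemma free_eval_gen q : free_eval << q >> = q.
Proof.
rewrite (free_evalE (d := [fset q])) ?msuppU_le // big_seq_fset1.
by rewrite mcoeffUU scale1r.
Qed.

End FreeCover.

(** A section of the free cover of Q has finitely many nonzero coordinates on each
y_i; keep those coordinates only. *)
Lemma dual_basis (R : nzRingType) (Q : lmodType R) m (y : 'I_m -> Q) :
  projective Q ->
  exists n (rho : LHom Q 'rV[R]_n) (b : LHom 'rV[R]_n Q),
    forall i, b (rho (y i)) = y i.
Proof.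
move=> projQ.
have [|s sE] := projQ {malg R[Q]} Q (mklin (@free_eval_linear R Q)) idfun.
  by move=> q; exists << q >>; apply: free_eval_gen.
pose d : {fset Q} := (\bigcup_(i <- enum 'I_m) msupp (s (y i)))%fset.
have lrho : linear (fun q =>
    \row_(j < size d) (s q)@_(tnth (in_tuple d) j) : 'rV[R]_(size d)).
  by move=> a u v; apply/rowP => j; rewrite !mxE linearP mcoeffD mcoeffZ.
exists (size d), (mklin lrho), (lincomb (tnth (in_tuple d))) => i.
have yE : free_eval (s (y i)) = y i := sE (y i).
rewrite lincombE -[RHS]yE (free_evalE (d := d)); last first.
  by apply: bigfcup_sup; rewrite ?mem_enum.
rewrite [RHS](big_tnth _ _ d); apply: eq_bigr => j _.
by rewrite mklinE mxE.
Qed.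

Lemma projective_torsionless (R : nzRingType) (M Q : lmodType R) (e : LHom M Q) :
  fin_gen M -> projective Q -> injective e -> torsionless M.
Proof.
move=> /fin_genP[m [f fsurj]] projQ einj.
have [n [rho [b bE]]] := dual_basis (fun i => e (f (delta_mx 0 i))) projQ.
have bK : b \oh (rho \oh (e \oh f)) = e \oh f.
  by apply: row_hom_ext => i; apply: bE.
exists n, (rho \oh e) => x y.
have [u <-] := fsurj x; have [v <-] := fsurj y => /(congr1 b).
rewrite -[b _]/((b \oh (rho \oh (e \oh f))) u).
rewrite -[X in _ = X]/((b \oh (rho \oh (e \oh f))) v) bK.
exact: einj.
Qed.

Lemma row_projective (R : pzRingType) n : projective 'rV[R]_n.
Proof.
move=> M N g f gsurj.
have [h hE] := summand_reg_lift (f := g : LHom _ _) (f : LHom _ _)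
  (row_summand R n) gsurj.
by exists h => x; rewrite -[RHS]/((f : LHom _ _) x) -hE.
Qed.

(** * Lattices are syzygies of totally acyclic complexes *)

Section CompleteResolution.
Variable R : nzRingType.
Hypotheses
  (row_ker : row_kernels_fg R)
  (col_ker : forall m n (A : 'M[R]_(m, n)),
     exists l, exists B : 'M[R]_(n, l), cexact A B)
  (row_to_col : forall a b c d (A : 'M[R]_(a, b)) (B : 'M[R]_(b, c))
     (C : 'M[R]_(c, d)), rexact A B -> rexact B C -> cexact A B)
  (col_to_row : forall a b c d (A : 'M[R]_(a, b)) (B : 'M[R]_(b, c))
     (C : 'M[R]_(c, d)), cexact A B -> cexact B C -> rexact B C).

(** Matrices of all sizes in one type, so that the terms of a complex indexed by int
can be defined by cases; matching sizes become the equation in consecutive. *)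
Record anymx := AnyMx { nrows : nat; ncols : nat; themx : 'M[R]_(nrows, ncols) }.

Definition consecutive (x y : anymx) : Prop :=
  exists e : ncols x = nrows y,
    let A := castmx (erefl, e) (themx x) in
    rexact A (themx y) /\ cexact A (themx y).

Lemma consecutiveI (m n q : nat) (A : 'M[R]_(m, n)) (B : 'M[R]_(n, q)) :
  rexact A B -> cexact A B -> consecutive (AnyMx A) (AnyMx B).
Proof. by move=> AB BA; exists erefl; rewrite castmx_id. Qed.

(** To the left of A0 take row kernels x1, x2, ...; each pair is then column-exact
by the hypothesis row_to_col, except the pair (x1, A0). So replace A0 by the
column kernel B of x1: as A0 factors through B, the matrices A0 and B kill the
same rows, and (x1, B) is exact for both actions. To the right of B take column
kernels; these pairs are row-exact by col_to_row. The term after B is written z (0 + 1)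
because the terms of a complex are indexed as targets i + 1. *)
Lemma exact_sequence (m n : nat) (A0 : 'M[R]_(m, n)) :
  exists z : int -> anymx, exists B : 'M[R]_(m, nrows (z (0 + 1))),
  [/\ forall i, consecutive (z i) (z (i + 1)),
      rexact B (themx (z (0 + 1)))
    & forall p (V : 'M[R]_(p, m)), V *m B = 0 <-> V *m A0 = 0].
Proof.
have [lk lkP] : exists lk : forall x : anymx, {l : nat & 'M[R]_(l, nrows x)},
    forall x, rexact (tagged (lk x)) (themx x).
  have ex (x : anymx) : exists A : {l : nat & 'M[R]_(l, nrows x)},
      rexact (tagged A) (themx x).
    have [l [A AB]] := row_ker (themx x).
    by exists (existT (fun l => 'M_(l, nrows x)) l A).
  by exists (fun x => sval (cid (ex x))) => x; case: cid.
have [rk rkP] : exists rk : forall x : anymx, {l : nat & 'M[R]_(ncols x, l)},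
    forall x, cexact (themx x) (tagged (rk x)).
  have ex (x : anymx) : exists B : {l : nat & 'M[R]_(ncols x, l)},
      cexact (themx x) (tagged B).
    have [l [B AB]] := col_ker (themx x).
    by exists (existT (fun l => 'M_(ncols x, l)) l B).
  by exists (fun x => sval (cid (ex x))) => x; case: cid.
pose lker x := AnyMx (tagged (lk x)); pose rker x := AnyMx (tagged (rk x)).
pose x0 := AnyMx A0; pose x1 := lker x0.
pose z (i : int) := match i with
  | Posz j => rker (iter j rker x1) | Negz j => lker (iter j lker x0) end.
have x1B : rexact (themx x1) (tagged (rk x1)).
  move=> p V; split=> [VB|[U ->]]; last first.
    by rewrite -mulmxA (cexact_mul0 (rkP x1)) mulmx0.
  apply/(lkP x0); have [U A0E] := (rkP x1 _ A0).1 (rexact_mul0 (lkP x0)).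
  by rewrite -[themx x0]/A0 A0E mulmxA VB mul0mx.
exists z, (tagged (rk x1)); split; last first.
  by move=> p V; split=> [/x1B /(lkP x0)//|/(lkP x0)/x1B].
  exact: (col_to_row (rkP x1) (rkP (rker x1))).
case=> [j|[|j]].
- have -> : (Posz j + 1 = Posz j.+1)%R by rewrite -addn1.
  apply: (consecutiveI (B := tagged (rk (rker (iter j rker x1))))); last exact: rkP.
  exact: (col_to_row (rkP (iter j rker x1)) (rkP (rker (iter j rker x1)))).
- exact: (consecutiveI x1B (rkP x1)).
- have -> : (Negz j.+1 + 1 = Negz j)%R.
    by rewrite !NegzE -[j.+2]addn1 PoszD opprD addrK.
  apply: (consecutiveI (B := tagged (lk (iter j lker x0)))); first exact: lkP.
  exact: (row_to_col (lkP (lker (iter j lker x0))) (lkP (iter j lker x0))).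
Qed.

(** A map from a finite free term to a projective Q factors through a finite free
module by the dual basis lemma, in a way that preserves the cocycle condition;
so acyclicity of Hom(-, Q) reduces to column-exactness, even when Q is not
finitely generated. The lattice is isomorphic to the row space of A0, hence to
that of B, which is the kernel of the next map. *)
Lemma lattice_Gorenstein_projective (M : lmodType R) : lattice M ->
  Gorenstein_projective M.
Proof.
move=> [/fin_genP[m [p psurj]] [n [f finj]]].
have [A0 A0E] := hom_mulR (f \oh p).
have [z [B [zS BZ BA0]]] := exact_sequence A0.
pose e i := sval (cid (zS i)).
pose A i := castmx (erefl, e i) (themx (z i)).
have AZ i : rexact (A i) (themx (z (i + 1))) /\ cexact (A i) (themx (z (i + 1))).
  exact: svalP (cid (zS i)).
have AR i : rexact (A i) (A (i + 1)) by apply/rexact_cast/(AZ i).1.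
have AC i : cexact (A i) (A (i + 1)) by apply/cexact_cast/(AZ i).2.
exists (fun i => 'rV[R]_(nrows (z i))), (fun i => mulR (A i)); split.
  split=> [i|i x|Q projQ i h]; first exact: row_projective.
    split=> [/(AR i _ x).1[y ->]|[y <-]]; first by exists y.
    by rewrite !mulRE -mulmxA (rexact_mul0 (AR i)) mulmx0.
  split=> [hd|[g gE] x]; last first.
    rewrite -gE [mulR _ _]mulRE [mulR (A i) x]mulRE -mulmxA.
    by rewrite (rexact_mul0 (AR i)) mulmx0 linear0.
  have [t [rho [b bE]]] := dual_basis (fun j => h (delta_mx 0 j)) projQ.
  have [W WE] := hom_mulR (rho \oh (h : LHom _ _)).
  have [|U WU] := (AC i _ W).1.
    apply/row_matrixP => j; rewrite row_mul row0 rowE -[LHS]/(mulR W (mulR (A i) _)).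
    by rewrite -WE hcompE hd linear0.
  exists (b \oh mulR U) => x.
  transitivity ((b \oh (rho \oh (h : LHom _ _))) x).
    by rewrite WE WU !hcompE !mulRE mulmxA.
  rewrite -[RHS]/((h : LHom _ _) x); congr (lin_of_LHom _ x).
  by apply: row_hom_ext => j; apply: bE.
have [|h hE] := factor_surj (p := p) (f := mulR B : {linear _ -> _}) psurj.
  move=> c pc0; rewrite mulRE; apply/BA0.
  by rewrite -mulRE -A0E hcompE pc0 linear0.
exists (0 + 1), h; split=> [|x].
  apply: linear_inj0 => x; have [c <-] := psurj x.
  rewrite hE => /BA0; rewrite -mulRE -A0E hcompE => /eqP.
  by rewrite -(linear0 f) => /eqP/finj.
split=> [xA|[y <-]].
  have [|c ->] := (rexact_cast (e (0 + 1)) BZ x).1; first exact: xA.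
  by exists (p c); rewrite hE.
have [c <-] := psurj y; rewrite hE mulRE.
by apply/(rexact_cast (e (0 + 1)) BZ); exists c.
Qed.

End CompleteResolution.

(** A syzygy embeds in a projective module, and a finitely generated one in a finite
free module. *)
Lemma Gprj_iff_lattice (k : comPzRingType) (L : algType k) :
  artin_algebra L -> Gorenstein L 1 ->
  forall M : rmodType L, Gprj M <-> lattice M.
Proof.
move=> [artk [r [g gen]]] [[idL _] [idR _]] M; split=> [[fgM]|latM].
  move=> [P [d [[projP _ _] [i [e [einj _]]]]]]; split=> //.
  exact: (@projective_torsionless L^c M (P i) e).
have noethk := artinian_noetherian artk.
pose iota (c : k) : L := c%:A.
have iB : zmod_morphism iota by move=> a b; rewrite /iota scalerBl.
have iM : monoid_morphism iota.
  by split=> [|a b]; rewrite /iota ?scale1r // -scalerAl mul1r scalerA.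
have iM' : monoid_morphism (iota : k -> L^c).
  split=> [|a b]; first by rewrite /iota scale1r.
  by rewrite mulrC; apply: iM.2.
pose i1 : {rmorphism k -> L} :=
  HB.pack iota (GRing.isZmodMorphism.Build k L iota iB)
    (GRing.isMonoidMorphism.Build k L iota iM).
pose i2 : {rmorphism k -> L^c} :=
  HB.pack (iota : k -> L^c) (GRing.isZmodMorphism.Build k L^c iota iB)
    (GRing.isMonoidMorphism.Build k L^c iota iM').
have kerL : row_kernels_fg L.
  apply: (row_kernels_fg_of_scalars (i := i1) (g := g)) noethk => x.
  have [c ->] := gen x; exists c; apply: eq_bigr => j _.
  by rewrite -scalerAl mul1r.
have kerR : row_kernels_fg L^c.
  apply: (row_kernels_fg_of_scalars (i := i2) (g := g : 'I_r -> L^c)) noethk => x.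
  have [c ->] := gen x; exists c; apply: eq_bigr => j _.
  by rewrite -[RHS]/(g j * (c j)%:A) -scalerAr mulr1.
split; first by case: latM.
apply: (@lattice_Gorenstein_projective L^c) latM => //.
- exact: col_kernels_fg.
- by move=> a b c d A B C; apply: cexact_of_inj_dim.
- by move=> a b c d A B C; apply: rexact_of_inj_dim.
Qed.

Theorem theorem4p2 (k k' : comPzRingType) (L : algType k) (L' : algType k')
    (artL : artin_algebra L) (artL' : artin_algebra L')
    (gorL : Gorenstein L 1) (gorL' : Gorenstein L' 1)
    (cmL : finite_CM_type L) (cmL' : finite_CM_type L')
    (G : rmodType L) (genG : additive_generator_Gprj G)
    (G' : rmodType L') (genG' : additive_generator_Gprj G') :
  Morita_equivalent L L' <-> Morita_equivalent (End_mod G) (End_mod G').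
Proof.
have latG (M : rmodType L) : lattice M <-> summand_of M G.
  by rewrite -(Gprj_iff_lattice artL gorL) genG in_addP.
have latG' (M : rmodType L') : lattice M <-> summand_of M G'.
  by rewrite -(Gprj_iff_lattice artL' gorL') genG' in_addP.
by split; [apply: Morita_End_generators | apply: Morita_of_End_generators].
Qed.
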